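(* (a) Let $f:[0,1]^d\to\mathbb{R}$ be right-continuous (right-continuous in each coordinate at every point) with bounded Hardy–Krause variation. Then there exists a unique signed Borel measure $\nu$ on $[0,1]^d$ with $f(\mathbf{x})=\nu([\mathbf{0},\mathbf{x}])$ for all $\mathbf{x}\in[0,1]^d$, and for it $\operatorname{Var}_{\mathrm{tot}}\nu=\operatorname{Var}_{HK\mathbf{0}} f+|f(\mathbf{0})|$. Moreover, if $f=f(\mathbf{0})+f^+-f^-$ is the Jordan decomposition of $f$ and $\nu=\nu^+-\nu^-$ is the Jordan decomposition of $\nu$, then $f^+(\mathbf{x})=\nu^+([\mathbf{0},\mathbf{x}]\setminus\{\mathbf{0}\})$ and $f^-(\mathbf{x})=\nu^-([\mathbf{0},\mathbf{x}]\setminus\{\mathbf{0}\})$ for all $\mathbf{x}\in[0,1]^d$. (b) Let $\nu$ be a finite signed Borel measure on $[0,1]^d$. Then there exists a unique right-continuous function $f$ of bounded Hardy–Krause variation on $[0,1]^d$ such that $f(\mathbf{x})=\nu([\mathbf{0},\mathbf{x}])$ for all $\mathbf{x}$ and $\operatorname{Var}_{\mathrm{tot}}\nu=\operatorname{Var}_{HK\mathbf{0}} f+|f(\mathbf{0})|$; moreover, with the Jordan decompositions as in (a), $f^\pm(\mathbf{x})=\nu^\pm([\mathbf{0},\mathbf{x}]\setminus\{\mathbf{0}\})$ for all $\mathbf{x}$.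
   Context: Quasi-volumes $\Delta^{(s)}$ of $s$-dimensional closed axis-parallel boxes: for $[\mathbf{a},\mathbf{b}]$, $\Delta^{(d)}(f;[\mathbf{a},\mathbf{b}])=\sum_{j\in\{0,1\}^d}(-1)^{\sum j_i}f(b_1+j_1(a_1-b_1),\dots,b_d+j_d(a_d-b_d))$, and analogously in lower dimension. Vitali variation of $f$ on a box: supremum over grid partitions of the box of $\sum|\Delta|$ over the cells. $\operatorname{Var}_{HK} f$ (anchored at $\mathbf{1}$) is the sum over nonempty $\{i_1<\dots<i_s\}\subseteq\{1,\dots,d\}$ of the Vitali variation of $f$ restricted to the face $\{x_j=1, j\notin\{i_1,\dots,i_s\}\}$; bounded HK-variation means this is finite. $\operatorname{Var}_{HK\mathbf{0}} f$ is the same sum over the faces $\{x_j=0, j\notin\{i_1,\dots,i_s\}\}$. A function is completely monotone if all its quasi-volumes of all closed axis-parallel boxes of all dimensions are $\ge0$. For $f$ of bounded HK-variation, its Jordan decomposition is the unique representation $f(\mathbf{x})=f(\mathbf{0})+f^+(\mathbf{x})-f^-(\mathbf{x})$ with $f^\pm$ completely monotone, $f^\pm(\mathbf{0})=0$ and $\operatorname{Var}_{HK\mathbf{0}} f=\operatorname{Var}_{HK\mathbf{0}} f^++\operatorname{Var}_{HK\mathbf{0}} f^-$ (existence and uniqueness being known). For a signed measure $\nu$, its Jordan decomposition $\nu=\nu^+-\nu^-$ is the unique one with mutually singular measures $\nu^\pm$, and $\operatorname{Var}_{\mathrm{tot}}\nu=\nu^+([0,1]^d)+\nu^-([0,1]^d)$.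 *)

(* Defs.v *)
From HB Require Import structures.
From mathcomp Require Import all_boot all_order all_algebra.
From mathcomp Require Import all_classical all_reals all_analysis.
Set Implicit Arguments. Unset Strict Implicit. Unset Printing Implicit Defensive.
Import Order.TTheory GRing.Theory Num.Theory.
Import numFieldNormedType.Exports.
Local Open Scope classical_set_scope.
Local Open Scope ring_scope.

(** Points of R^d are d-tuples of reals; [d.-tuple R] carries the product
    (= Borel) sigma-algebra of the Borel sigma-algebra of R. *)

Section HK.
Variables (R : realType) (d : nat).
Implicit Types (f : d.-tuple R -> R) (x a b c : d.-tuple R) (u : {set 'I_d}).

Definition in01 x := forall i : 'I_d, 0 <= tnth x i <= 1.
Definition cube01 : set (d.-tuple R) := [set x | in01 x].

Definition pt0 : d.-tuple R := [tuple (0 : R) | i < d].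
Definition pt1 : d.-tuple R := [tuple (1 : R) | i < d].

Definition upd x (i : 'I_d) (s : R) : d.-tuple R :=
  [tuple (if j == i then s else tnth x j) | j < d].

Definition box0 x : set (d.-tuple R) :=
  [set y | forall i : 'I_d, 0 <= tnth y i <= tnth x i].

(** Quasi-volume of the |u|-dimensional box with corners a, b in the
    coordinates of u, the other coordinates being fixed to those of c:
    sum over j in {0,1}^u (encoded as J subset of u, J = {i | j_i = 1})
    of (-1)^{sum j} f(point with coordinate a_i if j_i = 1, b_i if j_i = 0,
    c_i off u). *)
Definition qvol f u c a b : R :=
  \sum_(J in powerset u)
     (-1) ^+ #|J| *
     f [tuple (if j \in J then tnth a j else if j \in u then tnth b j
               else tnth c j) | j < d].

Definition grid u (n : 'I_d -> nat) (t : 'I_d -> nat -> R) :=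
  forall i, i \in u ->
    [/\ (0 < n i)%N, t i 0%N = 0, t i (n i) = 1 &
        forall l, (l < n i)%N -> t i l < t i l.+1].

(** sum of |quasi-volumes| over all cells of the grid; a cell is given by an
    index k i < n i for each i in u (k i = 0 for i not in u) *)
Definition grid_sum f u c (n : 'I_d -> nat) (t : 'I_d -> nat -> R) : R :=
  \sum_(k : {ffun 'I_d -> 'I_(\max_(i < d) n i)} |
         [forall i, if i \in u then (k i < n i)%N else (k i == 0%N :> nat)])
     `| qvol f u c [tuple t i (k i) | i < d] [tuple t i (k i).+1 | i < d] |.

(** Vitali variation of f restricted to the face {x_j = c_j, j not in u}
    (as a function on [0,1]^u) *)
Definition vitali_var f u c : \bar R :=
  ereal_sup [set v : \bar R | exists n t, grid u n t /\ v = (grid_sum f u c n t)%:E].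

Definition VarHK f : \bar R :=
  (\sum_(u : {set 'I_d} | (0 < #|u|)%N) vitali_var f u pt1)%E.
Definition VarHK0 f : \bar R :=
  (\sum_(u : {set 'I_d} | (0 < #|u|)%N) vitali_var f u pt0)%E.

Definition bounded_HK f := (VarHK f < +oo)%E.

Definition completely_monotone f :=
  forall u c a b, (0 < #|u|)%N -> in01 c ->
    (forall i, 0 <= tnth a i <= tnth b i /\ tnth b i <= 1) ->
    0 <= qvol f u c a b.

Definition jordan_fun f (fp fm : d.-tuple R -> R) :=
  [/\ forall x, in01 x -> f x = f pt0 + fp x - fm x,
      fp pt0 = 0 /\ fm pt0 = 0,
      completely_monotone fp, completely_monotone fm &
      VarHK0 f = (VarHK0 fp + VarHK0 fm)%E].

Definition right_continuous01 f :=
  forall x (i : 'I_d), in01 x -> tnth x i < 1 ->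
    (fun s => f (upd x i s)) @ (tnth x i)^'+ --> f x.

(** a (finite) signed Borel measure on R^d, viewed as a signed Borel measure
    on [0,1]^d: it is concentrated on [0,1]^d *)
Definition on_cube (nu : set (d.-tuple R) -> \bar R) :=
  forall A, measurable A -> nu A = nu (A `&` cube01).

Definition jordan_charge (nu : {charge set (d.-tuple R) -> \bar R})
    (np nm : {measure set (d.-tuple R) -> \bar R}) :=
  (exists P, [/\ measurable P, np (~` P) = 0%E & nm P = 0%E]) /\
  (forall A, measurable A -> nu A = (np A - nm A)%E).

(** total variation identity Var_tot nu = Var_HK0 f + |f(0)|, where
    Var_tot nu = nu^+([0,1]^d) + nu^-([0,1]^d) for the Jordan decomposition *)
Definition var_identity (nu : {charge set (d.-tuple R) -> \bar R}) f :=
  forall np nm, jordan_charge nu np nm ->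
    (np cube01 + nm cube01 = VarHK0 f + (`|f pt0|)%:E)%E.

Definition jordan_match (nu : {charge set (d.-tuple R) -> \bar R}) f :=
  forall fp fm np nm, jordan_fun f fp fm -> jordan_charge nu np nm ->
    forall x, in01 x ->
      (fp x)%:E = np (box0 x `\ pt0) /\ (fm x)%:E = nm (box0 x `\ pt0).

Definition represents (nu : {charge set (d.-tuple R) -> \bar R}) f :=
  forall x, in01 x -> nu (box0 x) = (f x)%:E.

End HK.

(* Main.v *)
Require Import Defs.
From HB Require Import structures.
From mathcomp Require Import all_boot all_order all_algebra.
From mathcomp Require Import all_classical all_reals all_analysis.
From mathcomp Require Import measurable_realfun ring lra.
Set Implicit Arguments. Unset Strict Implicit. Unset Printing Implicit Defensive.
Import Order.TTheory GRing.Theory Num.Theory.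
Import numFieldNormedType.Exports.
Local Open Scope classical_set_scope.
Local Open Scope ring_scope.

(** Extend f by 0 to the points having a negative coordinate. The increments of
    the extension over d-dimensional boxes (a, b] then contain the quasi-volumes
    of f on all the faces of the cube through 0, so that Var_HK0 f + |f(0)| is
    the total variation of one additive function of boxes, and this variation is
    again additive and inherits right-continuity from f. A nonnegative additive
    right-continuous box function M is the distribution function of a measure:
    bisecting the boxes repeatedly codes each of them by an interval of length
    M, and the limit of the boxes coded by a real number is a random point whose
    law under Lebesgue measure is the required one. Half the sum and half the
    difference of the variation and of the increment give a charge representing
    f, whose total mass bounds the one of the Jordan decomposition by the
    variation. Conversely the positive and negative parts of a charge dominate
    the quasi-volumes of its distribution function, which bounds the variation
    by the total mass. Equality throughout, together with additivity, determines
    the Jordan decomposition of f. *)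

(** * Quasi-volumes *)

(** Realising the measure as an image of Lebesgue measure leaves no countable additivity to prove in
    dimension d. What remains is to identify the masses of orthants: bisection bounds open orthants
    from above and closed ones from below, and right-continuity closes the gap. Variation is
    computed with hyperplane cuts of arbitrary boxes rather than with grids, because a list of cuts
    restricts to every sub-box and additivity becomes an induction on the list; grids return only in
    a comparison on the whole box. Two mismatches have to be bridged: bounded variation is anchored
    at 1 while the identity is anchored at 0, and the measures [np], [nm] of [jordan_charge] are
    arbitrary, not known to be finite. With [g] the sum of their distribution functions and [V] the
    variation of [bvol f] over the whole box, all equalities come from the cycle Var_HK0 f + |f(0)|
    <= g(1) <= V <= Var_HK0 f + |f(0)|. *)

Section QuasiVolume.
Variables (R : realType) (d : nat).
Implicit Types (f g : d.-tuple R -> R) (x a b c : d.-tuple R) (u : {set 'I_d}).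
Implicit Types (phi : 'I_d -> R -> R).

Lemma tnth_upd x i s j : tnth (upd x i s) j = if j == i then s else tnth x j.
Proof. by rewrite tnth_mktuple. Qed.

Definition prod_vol phi u c a b :=
  \prod_i (if i \in u then phi i (tnth b i) - phi i (tnth a i)
           else phi i (tnth c i)).

(** Distributivity: choosing in each factor either -phi_i(a_i) or phi_i(b_i) selects a vertex of the
    box together with its sign. Off [u] the first summand is set to 0, which removes the sets J not
    contained in [u]. *)
Lemma prod_volE phi u c a b :
  qvol (fun x => \prod_i phi i (tnth x i)) u c a b = prod_vol phi u c a b.
Proof.
pose A i := if i \in u then - phi i (tnth a i) else 0.
pose B i := if i \in u then phi i (tnth b i) else phi i (tnth c i).
rewrite /prod_vol (eq_bigr (fun i => A i + B i)); last first.
  by move=> i _; rewrite /A /B; case: ifP => _; rewrite ?add0r // addrC.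
rewrite bigA_distr [RHS](bigID (fun J => J \in powerset u)) /=.
rewrite [X in _ = _ + X]big1 ?addr0; last first.
  move=> J; rewrite powersetE => /subsetPn[i iJ iu].
  by rewrite (bigD1 i) //= iJ /A (negPf iu) mul0r.
apply: eq_bigr => J; rewrite powersetE => /fintype.subsetP Ju.
rewrite -prodr_const big_mkcond -big_split /=.
apply: eq_bigr => i _; rewrite tnth_mktuple /A /B.
by have [/Ju ->|_] := boolP (i \in J); rewrite ?mulN1r ?mul1r //; case: ifP.
Qed.

(** Each product is a Kronecker delta, so only the term of the coordinate vector of x survives. On
    the finite grid X^d this makes f a combination of products of functions of one coordinate. *)
Lemma interpolate f (X : seq R) x : (forall i, tnth x i \in X) ->
  f x = \sum_(p : {ffun 'I_d -> seq_sub X})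
    f [tuple ssval (p i) | i < d] * \prod_i (tnth x i == ssval (p i))%:R.
Proof.
move=> xX; rewrite (bigD1 [ffun i => SeqSub (xX i)]) //= [X in _ + X]big1.
  rewrite big1 ?addr0 ?mulr1; last by move=> i _; rewrite ffunE eqxx.
  by congr f; apply: eq_from_tnth => i; rewrite tnth_mktuple ffunE.
move=> p /eqP pN; case: (pickP (fun i => tnth x i != ssval (p i))) => [i ip|H].
  by rewrite (bigD1 i) //= (negPf ip) mul0r mulr0.
case: pN; apply/ffunP => i; apply: val_inj; rewrite ffunE /=.
by apply/esym/eqP; move: (H i) => /negbFE.
Qed.

Lemma eq_qvol f g u c a b :
  (forall J : {set 'I_d}, J \subset u ->
    let x := [tuple (if j \in J then tnth a j else if j \in u then tnth b j
                     else tnth c j) | j < d] in f x = g x) ->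
  qvol f u c a b = qvol g u c a b.
Proof.
by move=> H; apply: eq_bigr => J; rewrite powersetE => Ju; rewrite H.
Qed.

(* A function on a finite grid is a linear combination of products of functions
   of one coordinate, so linear identities between quasi-volumes need only be
   checked on such products. *)
Lemma qvol_ext f (I : finType) (P : pred I) (u : I -> {set 'I_d})
    (c a b : I -> d.-tuple R) u' c' a' b' :
  (forall phi, \sum_(k | P k) prod_vol phi (u k) (c k) (a k) (b k) =
               prod_vol phi u' c' a' b') ->
  \sum_(k | P k) qvol f (u k) (c k) (a k) (b k) = qvol f u' c' a' b'.
Proof.
move=> H.
pose Y (a b c : d.-tuple R) := val a ++ val b ++ val c.
(* All coordinates of all corners in the identity, so that a single finite grid carries every
   evaluation of f. *)
pose X := Y a' b' c' ++ flatten [seq Y (a k) (b k) (c k) | k : I].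
pose phi (p : {ffun 'I_d -> seq_sub X}) (i : 'I_d) s := (s == ssval (p i))%:R : R.
have key v c0 a0 b0 : (forall z, z \in val a0 ++ val b0 ++ val c0 -> z \in X) ->
  qvol f v c0 a0 b0 = \sum_(p : {ffun 'I_d -> seq_sub X})
     f [tuple ssval (p i) | i < d] * prod_vol (phi p) v c0 a0 b0.
  move=> sub.
  under eq_bigr do rewrite -prod_volE /qvol mulr_sumr.
  rewrite exchange_big /=; apply: eq_bigr => J _.
  rewrite (@interpolate _ X) => [|i].
    by rewrite mulr_sumr; apply: eq_bigr => p _; rewrite mulrCA.
  rewrite tnth_mktuple; apply: sub; rewrite !mem_cat.
  by case: ifP => _; [|case: ifP => _]; rewrite mem_tnth ?orbT.
rewrite (eq_bigr (fun k => \sum_(p : {ffun 'I_d -> seq_sub X})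
     f [tuple ssval (p i) | i < d] *
     prod_vol (phi p) (u k) (c k) (a k) (b k))) => [|k _]; last first.
  apply: key => z zk; rewrite /X mem_cat; apply/orP; right.
  by apply/flatten_mapP; exists k => //; rewrite mem_enum.
rewrite key; last by move=> z zk; rewrite /X mem_cat zk.
rewrite exchange_big /=; apply: eq_bigr => p _.
by rewrite -mulr_sumr H.
Qed.

Lemma qvol_ext2 f u1 c1 a1 b1 u2 c2 a2 b2 u c a b :
  (forall phi, prod_vol phi u1 c1 a1 b1 + prod_vol phi u2 c2 a2 b2 =
               prod_vol phi u c a b) ->
  qvol f u1 c1 a1 b1 + qvol f u2 c2 a2 b2 = qvol f u c a b.
Proof.
move=> H.
have E := @qvol_ext f bool xpredT (fun t => if t then u1 else u2)
  (fun t => if t then c1 else c2) (fun t => if t then a1 else a2)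
  (fun t => if t then b1 else b2) u c a b.
by rewrite big_bool in E; apply: E => phi; rewrite big_bool /= H.
Qed.

Lemma qvol0 f c a b : qvol f finset.set0 c a b = f c.
Proof.
rewrite /qvol finset.powerset0 big_set1 cards0 expr0 mul1r; congr f.
by apply: eq_from_tnth => i; rewrite tnth_mktuple !finset.in_set0.
Qed.

(** Differencing in one more direction: the quasi-volume over [i |: u] is the difference of those
    over [u] on two opposite facets. Inductions on the dimension of a face rest on it. *)
Lemma qvol_setU1 f u i c a b : i \notin u ->
  qvol f (i |: u) c a b + qvol f u (upd c i (tnth a i)) a b =
  qvol f u (upd c i (tnth b i)) a b.
Proof.
move=> iu; apply: qvol_ext2 => phi; rewrite /prod_vol.
have aux s : \prod_(j | j != i)
    (if j \in u then phi j (tnth b j) - phi j (tnth a j)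
     else phi j (tnth (upd c i s) j)) =
  \prod_(j | j != i)
    (if j \in i |: u then phi j (tnth b j) - phi j (tnth a j)
     else phi j (tnth c j)).
  by apply: eq_bigr => j ji; rewrite !inE tnth_upd (negPf ji).
rewrite (bigD1 i)//= [X in _ + X](bigD1 i)//= [RHS](bigD1 i)//= !aux -mulrDl.
by rewrite !tnth_upd !eqxx (negPf iu) finset.setU11 subrK.
Qed.

Lemma qvol_cut f u i c a b s : i \in u ->
  qvol f u c a (upd b i s) + qvol f u c (upd a i s) b = qvol f u c a b.
Proof.
move=> iu; apply: qvol_ext2 => phi; rewrite /prod_vol.
rewrite (bigD1 i)//= [X in _ + X](bigD1 i)//= [RHS](bigD1 i)//=.
rewrite (eq_bigr (fun j => if j \in u then phi j (tnth b j) - phi j (tnth a j)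
             else phi j (tnth c j))); last first.
  by move=> j ji; rewrite !tnth_upd (negPf ji).
rewrite [X in _ + _ * X](eq_bigr (fun j => if j \in u then phi j (tnth b j) - phi j (tnth a j)
             else phi j (tnth c j))); last first.
  by move=> j ji; rewrite !tnth_upd (negPf ji).
by rewrite -mulrDl iu !tnth_upd eqxx [X in X * _]addrC addrA subrK.
Qed.

(** Cutting at a_i returns the same box twice, so its quasi-volume v satisfies v + v = v. *)
Lemma qvol_degen f u i c a b : i \in u -> tnth a i = tnth b i ->
  qvol f u c a b = 0.
Proof.
move=> iu ab; have := @qvol_cut f u i c a b (tnth a i) iu.
have -> : upd b i (tnth a i) = b.
  by apply: eq_from_tnth => j; rewrite tnth_upd; case: eqP => // ->.
have -> : upd a i (tnth a i) = a.
  by apply: eq_from_tnth => j; rewrite tnth_upd; case: eqP => // ->.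
by rewrite -[RHS]add0r => /addIr.
Qed.

(* Moebius inversion: a point value is the sum of the quasi-volumes of the
   relatively open faces of [0, x]. *)
Lemma sum_qvol f c x : \sum_u qvol f u c c x = f x.
Proof.
rewrite -[RHS](qvol0 f x c c); apply: qvol_ext => phi.
rewrite /prod_vol [RHS](eq_bigr (fun i => (phi i (tnth x i) - phi i (tnth c i)) +
  phi i (tnth c i))) => [|i _]; last by rewrite inE subrK.
by rewrite bigA_distr; apply: eq_big => // u; rewrite finset.in_setT.
Qed.

Lemma qvolD f g u c a b :
  qvol (fun x => f x + g x) u c a b = qvol f u c a b + qvol g u c a b.
Proof. by rewrite /qvol -big_split; apply: eq_bigr => J _; rewrite mulrDr. Qed.

Lemma qvolN f u c a b : qvol (fun x => - f x) u c a b = - qvol f u c a b.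
Proof. by rewrite /qvol -sumrN; apply: eq_bigr => J _; rewrite mulrN. Qed.

Lemma qvol_cst (k : R) u c a b : (0 < #|u|)%N -> qvol (fun=> k) u c a b = 0.
Proof.
case/card_gt0P => i iu; have := @qvol_setU1 (fun=> k) (u :\ i) i c a b.
rewrite finset.setD1K // !inE eqxx /= => /(_ isT).
by rewrite -[RHS]add0r => /addIr.
Qed.

(** The index predicate of [grid_sum] with a free bound [N] on the indices, so that the grids on all
    the faces can share one index type. *)
Definition cells u (n : 'I_d -> nat) N : pred {ffun 'I_d -> 'I_N} :=
  fun k => [forall i, if i \in u then (k i < n i)%N else (k i == 0%N :> nat)].

Lemma prod_cells u (n : 'I_d -> nat) N (G : 'I_d -> nat -> R) (H : 'I_d -> R) :
  (0 < N)%N -> (forall i, i \in u -> (n i <= N)%N) ->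
  \sum_(k | @cells u n N k) \prod_i (if i \in u then G i (k i) else H i) =
  \prod_i (if i \in u then \sum_(0 <= j < n i) G i j else H i).
Proof.
move=> N0 nN.
pose Q i (j : 'I_N) := if i \in u then (j < n i)%N else (j == 0%N :> nat).
transitivity (\prod_i \sum_(j | Q i j) (if i \in u then G i j else H i)).
  rewrite bigA_distr_big_dep; apply: eq_bigl => k.
  by apply/forallP/familyP => h i; have := h i; rewrite unfold_in.
apply: eq_bigr => i _; rewrite /Q; case: ifP => iu.
  by rewrite big_mkord (big_ord_widen_cond N xpredT) ?nN.
by rewrite (big_pred1 (Ordinal N0)).
Qed.

Lemma qvol_grid f u c (t : 'I_d -> nat -> R) n N :
  (0 < N)%N -> (forall i, i \in u -> (n i <= N)%N) ->
  \sum_(k | @cells u n N k)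
     qvol f u c [tuple t i (k i) | i < d] [tuple t i (k i).+1 | i < d] =
  qvol f u c [tuple t i 0%N | i < d] [tuple t i (n i) | i < d].
Proof.
move=> N0 nN; apply: (@qvol_ext f _ _ (fun=> u) (fun=> c)
  (fun k : {ffun 'I_d -> 'I_N} => [tuple t i (k i) | i < d])
  (fun k => [tuple t i (k i).+1 | i < d])) => phi.
pose G i j := phi i (t i j.+1) - phi i (t i j).
transitivity (\sum_(k | @cells u n N k)
    \prod_i (if i \in u then G i (k i) else phi i (tnth c i))).
  apply: eq_bigr => k _; apply: eq_bigr => i _.
  by rewrite !tnth_mktuple.
rewrite prod_cells //; apply: eq_bigr => i _.
case: ifP => // iu; rewrite !tnth_mktuple /G.
by rewrite (telescope_sumr (fun j => phi i (t i j))).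
Qed.

(* The cells of the grids on all the faces through the corner partition the
   whole box. *)
Lemma qvol_faces_grid f c (s : 'I_d -> R) (t : 'I_d -> nat -> R) n N :
  (0 < N)%N -> (forall i, (n i <= N)%N) ->
  \sum_(u : {set 'I_d}) \sum_(k | @cells u n N k)
     qvol f [set: 'I_d]%SET c [tuple if i \in u then t i (k i) else s i | i < d]
       [tuple if i \in u then t i (k i).+1 else t i 0%N | i < d] =
  qvol f [set: 'I_d]%SET c [tuple s i | i < d] [tuple t i (n i) | i < d].
Proof.
move=> N0 nN; pose A (q : {set 'I_d} * {ffun 'I_d -> 'I_N}) :=
  [tuple if i \in q.1 then t i (q.2 i) else s i | i < d].
pose B (q : {set 'I_d} * {ffun 'I_d -> 'I_N}) :=
  [tuple if i \in q.1 then t i (q.2 i).+1 else t i 0%N | i < d].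
rewrite (pair_big_dep xpredT (fun u k => @cells u n N k)
  (fun u k => qvol f [set: 'I_d]%SET c (A (u, k)) (B (u, k)))) /=.
apply: (@qvol_ext f _ _ (fun=> [set: 'I_d]%SET) (fun=> c)
  (fun q => A (q.1, q.2)) (fun q => B (q.1, q.2))) => phi.
rewrite -(pair_big_dep xpredT (fun u k => @cells u n N k) (fun u k =>
  prod_vol phi [set: 'I_d]%SET c (A (u, k)) (B (u, k)))) /=.
pose G i j := phi i (t i j.+1) - phi i (t i j).
pose H i := phi i (t i 0%N) - phi i (s i).
(* In each coordinate the increment from s_i to the last grid point is the telescoping sum over the
   grid plus the first gap [H i]; expanding the product, the coordinates that choose the grid form
   the face [u]. *)
rewrite /prod_vol [RHS](eq_bigr (fun i => \sum_(0 <= j < n i) G i j + H i)).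
  rewrite bigA_distr; apply: eq_big => [u|u _]; first by rewrite inE.
  rewrite -(@prod_cells u n N G H) //; apply: eq_bigr => k _.
  apply: eq_bigr => i _; rewrite finset.in_setT !tnth_mktuple /G /H /=.
  by case: ifP.
move=> i _; rewrite finset.in_setT !tnth_mktuple /G.
by rewrite (telescope_sumr (fun j => phi i (t i j))) // addrA subrK.
Qed.

End QuasiVolume.

(** * Additive box functions *)

Section BoxFunction.
Variables (R : realType) (d : nat).
Implicit Types (x a b y : d.-tuple R) (M : d.-tuple R -> d.-tuple R -> R).

Definition le_pt a b := forall i, tnth a i <= tnth b i.
Definition lt_pt a b := forall i, tnth a i < tnth b i.

Lemma le_pt_refl a : le_pt a a. Proof. by move=> i. Qed.

Lemma le_pt_trans b a y : le_pt a b -> le_pt b y -> le_pt a y.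
Proof. by move=> ab bc i; exact: le_trans (ab i) (bc i). Qed.

Lemma le_pt_updr a b i r : le_pt a b -> tnth a i <= r -> le_pt a (upd b i r).
Proof. by move=> ab ar j; rewrite tnth_upd; case: eqP => [->|_]. Qed.

Lemma le_pt_updl a b i r : le_pt a b -> r <= tnth b i -> le_pt (upd a i r) b.
Proof. by move=> ab ar j; rewrite tnth_upd; case: eqP => [->|_]. Qed.

Lemma upd_id a i : upd a i (tnth a i) = a.
Proof. by apply: eq_from_tnth => j; rewrite tnth_upd; case: eqP => // ->. Qed.

Lemma upd_upd a i r s : upd (upd a i r) i s = upd a i s.
Proof. by apply: eq_from_tnth => j; rewrite !tnth_upd; case: eqP. Qed.

Lemma upd_comm a i j r s : i != j -> upd (upd a i r) j s = upd (upd a j s) i r.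
Proof.
move=> ij; apply: eq_from_tnth => k; rewrite !tnth_upd.
by case: eqP => // ->; rewrite eq_sym (negPf ij).
Qed.

(** The upper corner of the part of (a, b] lying below x; where x_i <= a_i it yields a_i, a
    degenerate box. *)
Definition clamp_pt a b x : d.-tuple R :=
  [tuple Num.max (tnth a i) (Num.min (tnth b i) (tnth x i)) | i < d].

Lemma clamp_pt_ge a b x : le_pt a (clamp_pt a b x).
Proof. by move=> i; rewrite tnth_mktuple le_max lexx. Qed.

Lemma clamp_pt_le a b x : le_pt a b -> le_pt (clamp_pt a b x) b.
Proof. by move=> ab i; rewrite tnth_mktuple ge_max ab ge_min lexx. Qed.

Lemma clamp_pt_id a b x : le_pt a x -> le_pt x b -> clamp_pt a b x = x.
Proof.
move=> ax xb; apply: eq_from_tnth => i; rewrite tnth_mktuple.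
by rewrite (min_idPr (xb i)) (max_idPr (ax i)).
Qed.

(** Every sub-box arises from (a0, b0] by two cuts per coordinate: cut at b_i and keep the lower
    part, then at a_i and keep the upper part. In the proof, [mx s] has the coordinates of [s]
    already trimmed. *)
Lemma box_ind (P : d.-tuple R -> d.-tuple R -> Prop) a0 b0 :
  (forall a b i r, le_pt a0 a -> le_pt a b -> le_pt b b0 ->
    tnth a i <= r <= tnth b i -> P a b -> P a (upd b i r) /\ P (upd a i r) b) ->
  P a0 b0 -> forall a b, le_pt a0 a -> le_pt a b -> le_pt b b0 -> P a b.
Proof.
move=> step P0 a b a0a ab bb0.
pose mx (s : seq 'I_d) (p q : d.-tuple R) : d.-tuple R :=
  [tuple if i \in s then tnth p i else tnth q i | i < d].
suff H s : P (mx s a a0) (mx s b b0).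
  have e p q : mx (enum 'I_d) p q = p.
    by apply: eq_from_tnth => i; rewrite tnth_mktuple mem_enum.
  by have := H (enum 'I_d); rewrite !e.
have key t : [/\ le_pt a0 (mx t a a0), le_pt (mx t b b0) b0 &
    le_pt (mx t a a0) (mx t b b0)].
  split=> j; rewrite !tnth_mktuple; case: ifP => _ //.
  by have := a0a j; have := ab j; have := bb0 j; lra.
elim: s => [|i s IH].
  have -> : mx [::] a a0 = a0 by apply: eq_from_tnth => i; rewrite tnth_mktuple.
  by have -> : mx [::] b b0 = b0 by apply: eq_from_tnth => i; rewrite tnth_mktuple.
have [k1 k2 k3] := key s.
have la : tnth (mx s a a0) i <= tnth a i by rewrite tnth_mktuple; case: ifP.
have lb : tnth b i <= tnth (mx s b b0) i by rewrite tnth_mktuple; case: ifP.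
have [] := step _ _ i (tnth b i) k1 k3 k2 _ IH.
  by rewrite lb (le_trans la).
move=> P1 _; have [] := step _ _ i (tnth a i) k1 _ _ _ P1.
- by apply: le_pt_updr => //; exact: le_trans (ab i).
- by apply: le_pt_updl => //; exact: le_trans lb (k2 i).
- by rewrite la tnth_upd eqxx ab.
have e p q : upd (mx s p q) i (tnth p i) = mx (i :: s) p q.
  apply: eq_from_tnth => j; rewrite !tnth_mktuple in_cons.
  by case: (eqVneq j i) => [->|].
by move=> _; rewrite !e.
Qed.

Section Additive.
Variables (a0 b0 : d.-tuple R) (M : d.-tuple R -> d.-tuple R -> R).
Hypothesis Madd : forall a b i r, le_pt a0 a -> le_pt a b -> le_pt b b0 ->
  tnth a i <= r <= tnth b i -> M a (upd b i r) + M (upd a i r) b = M a b.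
Hypothesis Mge0 : forall a b, le_pt a0 a -> le_pt a b -> le_pt b b0 -> 0 <= M a b.

Lemma box_fun_degen a b i : le_pt a0 a -> le_pt a b -> le_pt b b0 ->
  tnth a i = tnth b i -> M a b = 0.
Proof.
move=> a0a ab bb0 e; have := @Madd a b i (tnth a i) a0a ab bb0.
by rewrite upd_id e upd_id lexx => /(_ isT); lra.
Qed.

Lemma box_fun_mono a b a' b' : le_pt a0 a -> le_pt a a' -> le_pt a' b' ->
  le_pt b' b -> le_pt b b0 -> M a' b' <= M a b.
Proof.
move=> a0a aa' ab' bb' bb0; move: a' b' aa' ab' bb'.
apply: (@box_ind (fun p q => M p q <= M a b)) => //.
move=> p q i r ap pq qb pr pqM.
have a0p := le_pt_trans a0a ap; have qb0 := le_pt_trans qb bb0.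
have := Madd a0p pq qb0 pr; case/andP: pr => pr rq.
have : 0 <= M p (upd q i r).
  apply: Mge0 => //; first exact: le_pt_updr.
  by apply: le_pt_updl => //; exact: le_trans rq (qb0 i).
have : 0 <= M (upd p i r) q.
  apply: Mge0 => //; first by apply: le_pt_updr => //; exact: le_trans (a0p i) pr.
  exact: le_pt_updl.
by move: pqM; lra.
Qed.

(** A cut of (a, b] also cuts its part (a, z] below x: if r < z_i this is additivity for (a, z],
    otherwise (a, z] lies in the left half and the right contribution is degenerate. *)
Lemma box_fun_clamp a b x i r : le_pt a0 a -> le_pt a b -> le_pt b b0 ->
  tnth a i <= r <= tnth b i ->
  M a (clamp_pt a (upd b i r) x) + M (upd a i r) (clamp_pt (upd a i r) b x) =
  M a (clamp_pt a b x).
Proof.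
move=> a0a ab bb0 /andP[ar rb]; set z := clamp_pt a b x.
have az : le_pt a z by exact: clamp_pt_ge.
have zb : le_pt z b by exact: clamp_pt_le.
have zb0 := le_pt_trans zb bb0.
have [rz|/ltW zr] := leP r (tnth z i).
  rewrite -(Madd (i := i) (r := r) a0a az zb0) ?ar//.
  congr (M _ _ + M _ _); apply: eq_from_tnth => j;
    rewrite !(tnth_upd, tnth_mktuple);
    case: eqP => // ->; move: rz; rewrite /z tnth_mktuple.
    by rewrite !maxEle !minEle; repeat case: ifP => //; lra.
  by rewrite !maxEle !minEle; repeat case: ifP => //; lra.
rewrite [X in _ + X](_ : _ = 0) ?addr0.
  congr M; apply: eq_from_tnth => j; rewrite !(tnth_upd, tnth_mktuple);
    case: eqP => // ->; move: zr; rewrite /z tnth_mktuple.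
  by rewrite !maxEle !minEle; repeat case: ifP => //; lra.
have rab : le_pt (upd a i r) b by exact: le_pt_updl.
apply: (@box_fun_degen _ _ i).
- by apply: le_pt_updr => //; exact: le_trans (a0a i) ar.
- exact: clamp_pt_ge.
- exact: le_pt_trans (clamp_pt_le _ rab) bb0.
rewrite !(tnth_upd, tnth_mktuple) eqxx; move: zr; rewrite /z tnth_mktuple.
by rewrite !maxEle !minEle; repeat case: ifP => //; lra.
Qed.

End Additive.

End BoxFunction.

(** * From box functions to measures *)

Section ImageRestriction.
Context d1 d2 (T1 : measurableType d1) (T2 : measurableType d2) (R : realType).
Variables (m : {measure set T1 -> \bar R}) (f : T1 -> T2) (D : set T1).
Hypotheses (mf : measurable_fun setT f) (mD : measurable D).
Hypothesis finD : (m D < +oo)%E.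

(** The two proofs are arguments so that the measure and finite-measure structures can be attached
    to the constant. *)
Definition image_restr & measurable_fun setT f & (m D < +oo)%E : set T2 -> \bar R :=
  pushforward (mrestr m mD) f.

Local Notation mu := (image_restr mf finD).

Let mu0 : mu set0 = 0%E. Proof. exact: measure0. Qed.

Let mu_ge0 A : (0 <= mu A)%E. Proof. exact: measure_ge0. Qed.

Let mu_sigma_additive : semi_sigma_additive mu.
Proof. exact: measure_semi_sigma_additive. Qed.

HB.instance Definition _ := isMeasure.Build _ _ _ mu mu0 mu_ge0 mu_sigma_additive.

Let mu_fin : fin_num_fun mu.
Proof.
move=> A mA; rewrite ge0_fin_numE ?mu_ge0 // (le_lt_trans _ finD) //.
rewrite /image_restr /pushforward /mrestr; apply: le_measure; rewrite ?inE //.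
by apply: measurableI => //; rewrite -[X in measurable X]setTI; exact: mf.
Qed.

HB.instance Definition _ := Measure_isFinite.Build _ _ _ mu mu_fin.

End ImageRestriction.

Section MeasurableOrder.
Context (R : realType) (d : nat) d1 (T : measurableType d1).
Implicit Types (x : d.-tuple R).

Lemma measurable_le_pt x (F : T -> d.-tuple R) :
  (forall i, measurable_fun setT (fun w => tnth (F w) i)) ->
  measurable [set w | le_pt (F w) x].
Proof.
move=> mF.
rewrite (_ : [set _ | _] = \bigcap_(i in [set: 'I_d])
    [set w | tnth (F w) i <= tnth x i]); last first.
  by apply/seteqP; split=> w /= h i; [move=> _|]; exact: h.
apply: fin_bigcap_measurable => // i _; rewrite -[X in measurable X]setTI.
apply: (measurable_fun_ler (mF i) (measurable_cst _) measurableT (Y := [set true])).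
by [].
Qed.

Lemma measurable_lt_pt x (F : T -> d.-tuple R) :
  (forall i, measurable_fun setT (fun w => tnth (F w) i)) ->
  measurable [set w | lt_pt (F w) x].
Proof.
move=> mF.
rewrite (_ : [set _ | _] = \bigcap_(i in [set: 'I_d])
    [set w | tnth (F w) i < tnth x i]); last first.
  by apply/seteqP; split=> w /= h i; [move=> _|]; exact: h.
apply: fin_bigcap_measurable => // i _; rewrite -[X in measurable X]setTI.
apply: (measurable_fun_ltr (mF i) (measurable_cst _) measurableT (Y := [set true])).
by [].
Qed.

End MeasurableOrder.

Section BisectionMeasure.
Variables (R : realType) (d : nat).
Implicit Types (x a b y : d.-tuple R).
Variables (a0 b0 : d.-tuple R) (M : d.-tuple R -> d.-tuple R -> R).
Hypothesis a0b0 : le_pt a0 b0.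
Hypothesis Madd : forall a b i r, le_pt a0 a -> le_pt a b -> le_pt b b0 ->
  tnth a i <= r <= tnth b i -> M a (upd b i r) + M (upd a i r) b = M a b.
Hypothesis Mge0 : forall a b, le_pt a0 a -> le_pt a b -> le_pt b b0 -> 0 <= M a b.

Definition midpt a b i := (tnth a i + tnth b i) / 2.

(* The interval [s, s + M a b) codes the box (a, b]; each bisection of the box
   splits it into consecutive intervals whose lengths are the masses of the two
   halves, and w is followed into the half that it codes. *)
Fixpoint bisect (L : seq 'I_d) a b (s w : R) : d.-tuple R * d.-tuple R :=
  if L is i :: L' then
    let r := midpt a b i in
    let m := M a (upd b i r) in
    if w < s + m then bisect L' a (upd b i r) s w
    else bisect L' (upd a i r) b (s + m) w
  else (a, b).

Lemma midptP a b i : le_pt a b -> tnth a i <= midpt a b i <= tnth b i.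
Proof. by move=> ab; have := ab i; rewrite /midpt; lra. Qed.

Lemma bisect_left a b i : le_pt a b -> le_pt a (upd b i (midpt a b i)).
Proof. by move=> ab; apply: le_pt_updr => //; case/andP: (midptP i ab). Qed.

Lemma bisect_left_le a b i : le_pt a b -> le_pt (upd b i (midpt a b i)) b.
Proof. by move=> ab; apply: le_pt_updl => //; case/andP: (midptP i ab). Qed.

Lemma bisect_right a b i : le_pt a b -> le_pt (upd a i (midpt a b i)) b.
Proof. by move=> ab; apply: le_pt_updl => //; case/andP: (midptP i ab). Qed.

Lemma bisect_right_ge a b i : le_pt a b -> le_pt a (upd a i (midpt a b i)).
Proof. by move=> ab; apply: le_pt_updr => //; case/andP: (midptP i ab). Qed.

Lemma bisect_le L a b s w : le_pt a b ->
  [/\ le_pt a (bisect L a b s w).1, le_pt (bisect L a b s w).2 b &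
      le_pt (bisect L a b s w).1 (bisect L a b s w).2].
Proof.
elim: L a b s => [|i L IH] a b s ab /=; first by split=> // j.
case: ifP => _.
  have [h1 h2 h3] := IH _ _ s (bisect_left i ab).
  by split=> //; exact: le_pt_trans h2 (bisect_left_le i ab).
have [h1 h2 h3] := IH _ _ (s + M a (upd b i (midpt a b i))) (bisect_right i ab).
by split=> //; exact: le_pt_trans (bisect_right_ge i ab) h1.
Qed.

Lemma bisect_cat L1 L2 a b s w : le_pt a b ->
  le_pt (bisect L1 a b s w).1 (bisect (L1 ++ L2) a b s w).1 /\
  le_pt (bisect (L1 ++ L2) a b s w).2 (bisect L1 a b s w).2.
Proof.
elim: L1 a b s => [|i L IH] a b s ab /=.
  by have [] := bisect_le L2 s w ab.
by case: ifP => _; apply: IH; [exact: bisect_left|exact: bisect_right].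
Qed.

Lemma bisect_width L a b s w i :
  tnth (bisect L a b s w).2 i - tnth (bisect L a b s w).1 i =
  (tnth b i - tnth a i) / 2 ^+ count_mem i L.
Proof.
elim: L a b s => [|j L IH] a b s /=; first by rewrite expr0 divr1.
case: ifP => _; rewrite IH /midpt tnth_upd exprD;
  rewrite (eq_sym i) invfM mulrA; case: eqP => [->|_] /=;
  rewrite ?expr0 ?invr1 ?mulr1 ?expr1 //; congr (_ * _); lra.
Qed.

Lemma measurable_bisect L a b s i :
  measurable_fun setT (fun w => tnth (bisect L a b s w).1 i) /\
  measurable_fun setT (fun w => tnth (bisect L a b s w).2 i).
Proof.
elim: L a b s => [|j L IH] a b s /=; first by split; exact: measurable_cst.
set r := midpt a b j; set m := M _ _.
have mlt : measurable_fun setT (fun w : R => w < s + m).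
  by apply: measurable_fun_ltr; [exact: measurable_id|exact: measurable_cst].
split.
- under eq_fun do rewrite (fun_if fst) (fun_if (fun t => tnth t i)).
  by apply: measurable_fun_ifT => //; [exact: (IH _ _ _).1|exact: (IH _ _ _).1].
- under eq_fun do rewrite (fun_if snd) (fun_if (fun t => tnth t i)).
  by apply: measurable_fun_ifT => //; [exact: (IH _ _ _).2|exact: (IH _ _ _).2].
Qed.

Local Notation leb := (@lebesgue_measure R).

Definition code a b (s : R) : set R := [set w | s <= w < s + M a b].

Lemma codeE a b s : code a b s = `[s, s + M a b[%classic.
Proof. by apply/seteqP; split=> w /=; rewrite in_itv. Qed.

Lemma measurable_code a b s : measurable (code a b s).
Proof. by rewrite codeE. Qed.

Lemma leb_code a b s : 0 <= M a b -> leb (code a b s) = (M a b)%:E.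
Proof.
move=> M0; rewrite codeE lebesgue_measure_itv /= lte_fin.
case: ltP => h; first by rewrite -EFinB addrAC subrr add0r.
by congr EFin; lra.
Qed.

(** By additivity of [M] the codes of the two halves, placed end to end, fill the code of the box,
    and the test in [bisect] decides between them. An inclusion suffices, as only upper bounds for
    Lebesgue measure follow from it. *)
Lemma bisect_split L a b s i (P : set (d.-tuple R * d.-tuple R)) :
  le_pt a0 a -> le_pt a b -> le_pt b b0 ->
  let r := midpt a b i in
  code a b s `&` [set w | P (bisect (i :: L) a b s w)] `<=`
  (code a (upd b i r) s `&` [set w | P (bisect L a (upd b i r) s w)]) `|`
  (code (upd a i r) b (s + M a (upd b i r)) `&`
    [set w | P (bisect L (upd a i r) b (s + M a (upd b i r)) w)]).
Proof.
move=> a0a ab bb0 r w [/= /andP[sw wm]]; case: ifP => [h Pw|h Pw]; [left|right].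
  by split=> //=; rewrite /code /= sw.
split=> //=; rewrite /code /= -addrA (Madd a0a ab bb0 (midptP i ab)) wm andbT.
by rewrite leNgt h.
Qed.

(** A final box with upper corner below x lies inside the part of (a, b] below x, so such boxes have
    codes of total length at most the mass of that part. Both sides split along a bisection, by
    [bisect_split] and [box_fun_clamp]. *)
Lemma leb_bisect_le L a b s x : le_pt a0 a -> le_pt a b -> le_pt b b0 ->
  (leb (code a b s `&` [set w | le_pt (bisect L a b s w).2 x]) <=
   (M a (clamp_pt a b x))%:E)%E.
Proof.
have mB L' a' b' s' : measurable
    (code a' b' s' `&` [set w | le_pt (bisect L' a' b' s' w).2 x]).
  apply: measurableI; first exact: measurable_code.
  by apply: measurable_le_pt => i; exact: (measurable_bisect _ _ _ _ _).2.
elim: L a b s => [|i L IH] a b s a0a ab bb0.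
  have M0 : 0 <= M a (clamp_pt a b x).
    apply: Mge0 => //; first exact: clamp_pt_ge.
    exact: le_pt_trans (clamp_pt_le _ ab) bb0.
  have [bx|bx] := pselect (le_pt b x).
    apply: (@le_trans _ _ (leb (code a b s))).
      apply: le_measure; rewrite ?inE //; first exact: mB [::] _ _ _.
      exact: measurable_code.
    rewrite leb_code ?Mge0 // lee_fin le_eqVlt; apply/orP; left; apply/eqP.
    congr M; apply: eq_from_tnth => i; rewrite tnth_mktuple.
    by rewrite (min_idPl (bx i)) (max_idPr (ab i)).
  rewrite (_ : _ `&` _ = set0) ?measure0 ?lee_fin //.
  by apply/seteqP; split=> // w [].
set r := midpt a b i.
have rP := midptP i ab.
rewrite -(box_fun_clamp Madd x a0a ab bb0 rP) EFinD.
have sub := @bisect_split L a b s i (fun q => le_pt q.2 x) a0a ab bb0.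
apply: le_trans; first apply: (le_measure leb _ _ sub); rewrite ?inE.
- exact: mB (i :: L) _ _ _.
- by apply: measurableU; exact: mB.
apply: (le_trans (measureU2 _ _ _)); [exact: mB|exact: mB|].
apply: leeD; apply: IH => //.
- exact: bisect_left.
- exact: le_pt_trans (bisect_left_le i ab) bb0.
- exact: le_pt_trans a0a (bisect_right_ge i ab).
- exact: bisect_right.
Qed.

(** The complementary bound: a half-open box whose lower corner is not strictly below x misses the
    orthant below x, so such boxes share at most the mass outside it. *)
Lemma leb_bisect_nlt L a b s x : le_pt a0 a -> le_pt a b -> le_pt b b0 ->
  (leb (code a b s `&` [set w | ~ lt_pt (bisect L a b s w).1 x]) <=
   (M a b - M a (clamp_pt a b x))%:E)%E.
Proof.
have mB L' a' b' s' : measurable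
    (code a' b' s' `&` [set w | ~ lt_pt (bisect L' a' b' s' w).1 x]).
  apply: measurableI; first exact: measurable_code.
  apply: (@measurableC _ _ [set w | lt_pt (bisect L' a' b' s' w).1 x]).
  by apply: measurable_lt_pt => i; exact: (measurable_bisect _ _ _ _ _).1.
elim: L a b s => [|i L IH] a b s a0a ab bb0.
  have [ax|ax] := pselect (lt_pt a x).
    rewrite (_ : _ `&` _ = set0) ?measure0 ?lee_fin; last first.
      by apply/seteqP; split=> // w [].
    rewrite subr_ge0; exact: (box_fun_mono Madd Mge0 a0a (@le_pt_refl _ _ a)
      (clamp_pt_ge a b x) (clamp_pt_le x ab) bb0).
  have [i ix] : exists i, tnth x i <= tnth a i.
    apply: contrapT => h; apply: ax => i; rewrite ltNge; apply/negP => xi.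
    by apply: h; exists i.
  rewrite (@box_fun_degen _ _ a0 b0 M Madd a (clamp_pt a b x) i) //.
  - rewrite subr0 -(leb_code s (Mge0 a0a ab bb0)).
    by apply: le_measure; rewrite ?inE //; [exact: mB [::] _ _ _|exact: measurable_code].
  - exact: clamp_pt_ge.
  - exact: le_pt_trans (clamp_pt_le _ ab) bb0.
  - by rewrite tnth_mktuple (min_idPr (le_trans ix (ab i))) (max_idPl ix).
set r := midpt a b i.
have rP := midptP i ab.
rewrite -(box_fun_clamp Madd x a0a ab bb0 rP) -(Madd a0a ab bb0 rP).
rewrite opprD addrACA EFinD.
have sub := @bisect_split L a b s i (fun q => ~ lt_pt q.1 x) a0a ab bb0.
apply: le_trans; first apply: (le_measure leb _ _ sub); rewrite ?inE.
- exact: mB (i :: L) _ _ _.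
- by apply: measurableU; exact: mB.
apply: (le_trans (measureU2 _ _ _)); [exact: mB|exact: mB|].
apply: leeD; apply: IH => //.
- exact: bisect_left.
- exact: le_pt_trans (bisect_left_le i ab) bb0.
- exact: le_pt_trans a0a (bisect_right_ge i ab).
- exact: bisect_right.
Qed.

Fixpoint rounds q : seq 'I_d := if q is q'.+1 then rounds q' ++ enum 'I_d else [::].

Lemma count_rounds q i : count_mem i (rounds q) = q.
Proof.
elim: q => //= q IH; rewrite count_cat IH.
by rewrite (count_uniq_mem _ (enum_uniq _)) mem_enum addn1.
Qed.

Definition lo q w := (bisect (rounds q) a0 b0 0 w).1.
Definition hi q w := (bisect (rounds q) a0 b0 0 w).2.

Lemma hi_le q w : le_pt (hi q w) b0.
Proof. by have [] := bisect_le (rounds q) 0 w a0b0. Qed.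

Lemma lo_hi q w : le_pt (lo q w) (hi q w).
Proof. by have [] := bisect_le (rounds q) 0 w a0b0. Qed.

Lemma lo_homo q q' w : (q <= q')%N -> le_pt (lo q w) (lo q' w).
Proof.
move=> /subnK <-; elim: (q' - q)%N => [|n IH] //.
apply: (le_pt_trans IH); rewrite addSn.
by have [] := bisect_cat (rounds (n + q)) (enum 'I_d) 0 w a0b0.
Qed.

Lemma hi_homo q q' w : (q <= q')%N -> le_pt (hi q' w) (hi q w).
Proof.
move=> /subnK <-; elim: (q' - q)%N => [|n IH] //.
apply: le_pt_trans IH; rewrite addSn.
by have [] := bisect_cat (rounds (n + q)) (enum 'I_d) 0 w a0b0.
Qed.

(** The lower corners increase and stay below [b0], so the limit exists for every real w, even
    outside the code of (a0, b0]; restricting Lebesgue measure to that code discards the extra w. *)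
Definition decode (w : R) : d.-tuple R := [tuple limn (fun q => tnth (lo q w) i) | i < d].

Lemma decode_cvg w i : (fun q => tnth (lo q w) i) @ \oo --> tnth (decode w) i.
Proof.
rewrite tnth_mktuple; apply: nondecreasing_is_cvgn.
  by move=> q q' qq'; exact: lo_homo.
exists (tnth b0 i) => _ [q _ <-].
exact: le_trans (lo_hi q w i) (hi_le q w i).
Qed.

Lemma lo_decode q w : le_pt (lo q w) (decode w).
Proof.
move=> i; apply: (cvgr_to_ge (@decode_cvg w i)).
by exists q => // q' /= qq'; exact: lo_homo.
Qed.

Lemma measurable_lo q i : measurable_fun setT (fun w => tnth (lo q w) i).
Proof. exact: (measurable_bisect _ _ _ _ _).1. Qed.

Lemma measurable_hi q i : measurable_fun setT (fun w => tnth (hi q w) i).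
Proof. exact: (measurable_bisect _ _ _ _ _).2. Qed.

Lemma measurable_decode_tnth i : measurable_fun setT (fun w => tnth (decode w) i).
Proof.
apply/measurable_EFinP.
apply: (emeasurable_fun_cvg (fun q w => (tnth (lo q w) i)%:E)) => [q|w _].
  by apply/measurable_EFinP; exact: measurable_lo.
by apply/fine_cvgP; split; [exact: nearW|exact: decode_cvg].
Qed.

Lemma measurable_decode : measurable_fun setT decode.
Proof. by apply/measurable_fun_tnthP => i; exact: measurable_decode_tnth. Qed.

Lemma lt_decode w x : lt_pt (decode w) x -> exists q, le_pt (hi q w) x.
Proof.
move=> wx.
have /choice[q qP] : forall i, exists q, tnth (hi q w) i <= tnth x i.
  move=> i; have e0 : 0 < tnth x i - tnth (decode w) i by rewrite subr_gt0.
  pose W := tnth b0 i - tnth a0 i.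
  (* [Num.bound z] is an exponent q with z < 2^q, so after q rounds the width W / 2^q is below the
     gap between [decode w] and x. *)
  exists (Num.bound (W / (tnth x i - tnth (decode w) i))).
  set q := Num.bound _.
  have := lo_decode q w i; have := bisect_width (rounds q) a0 b0 0 w i.
  rewrite count_rounds -/(lo q w) -/(hi q w).
  have : W / 2 ^+ q < tnth x i - tnth (decode w) i.
    rewrite ltr_pdivrMr ?exprn_gt0 // mulrC -ltr_pdivrMr //.
    exact: Num.Theory.upper_nthrootP.
  rewrite -/W => h1 h2 h3; rewrite -(subrK (tnth (lo q w) i) (tnth (hi q w) i)) h2.
  by rewrite -lerBrDr (le_trans (ltW h1)) // lerD2l lerN2 h3.
exists (\max_i q i) => i; apply: le_trans (qP i).
by apply: hi_homo; exact: leq_bigmax.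
Qed.

Let leb_cvg_le (E : nat -> set R) (c : \bar R) :
  (forall n, measurable (E n)) -> {homo E : n m / (n <= m)%N >-> (n <= m)%O} ->
  (forall n, (leb (E n) <= c)%E) -> (leb (\bigcup_n E n) <= c)%E.
Proof.
move=> mE hE cE.
have h := @nondecreasing_cvg_mu _ _ _ leb E mE (bigcupT_measurable E mE) hE.
rewrite -(cvg_lim _ h) //; apply: lime_le; first by apply/cvg_ex; eexists; exact: h.
by apply: nearW => n; exact: cE.
Qed.

Let finC : (leb (code a0 b0 0) < +oo)%E.
Proof.
by rewrite leb_code ?ltry //; apply: Mge0 => //; exact: le_pt_refl.
Qed.

Definition box_measure := @image_restr _ _ _ _ _ leb decode _
  (measurable_code a0 b0 0) measurable_decode finC.

HB.instance Definition _ := FiniteMeasure.on box_measure.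

Lemma box_measureE A : box_measure A = leb (code a0 b0 0 `&` decode @^-1` A).
Proof. by rewrite /box_measure /image_restr /pushforward /mrestr setIC. Qed.

Lemma box_measureT : box_measure setT = (M a0 b0)%:E.
Proof.
rewrite box_measureE preimage_setT setIT leb_code //.
by apply: Mge0 => //; exact: le_pt_refl.
Qed.

(** If the limit is strictly below x, then by [lt_decode] some upper corner is already below x;
    continuity from below passes the bound for finitely many rounds to the limit. Strictness is
    essential here, hence open orthants. *)
Lemma box_measure_lt x :
  (box_measure [set y | lt_pt y x] <= (M a0 (clamp_pt a0 b0 x))%:E)%E.
Proof.
rewrite box_measureE.
pose E q := code a0 b0 0 `&` [set w | le_pt (hi q w) x].
have mE q : measurable (E q).
  apply: measurableI; first exact: measurable_code.
  by apply: measurable_le_pt; exact: measurable_hi.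
apply: (@le_trans _ _ (leb (\bigcup_q E q))).
  apply: le_measure; rewrite ?inE.
  - apply: measurableI; first exact: measurable_code.
    by apply: measurable_lt_pt; exact: measurable_decode_tnth.
  - exact: bigcupT_measurable.
  - by move=> w [cw /lt_decode[q qx]]; exists q.
apply: leb_cvg_le => // [n m nm|q].
  apply/subsetPset => w [cw h]; split=> //; exact: le_pt_trans (hi_homo w nm) h.
by apply: leb_bisect_le => //; exact: le_pt_refl.
Qed.

(** Bounds the complement: if the limit is not below x, some lower corner fails to be strictly below
    x, and [leb_bisect_nlt] applies. *)
Lemma box_measure_ge x :
  ((M a0 (clamp_pt a0 b0 x))%:E <= box_measure [set y | le_pt y x])%E.
Proof.
have mle : measurable [set w | le_pt (decode w) x].
  by apply: measurable_le_pt; exact: measurable_decode_tnth.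
have Mb : 0 <= M a0 b0 by apply: Mge0 => //; exact: le_pt_refl.
pose E q := code a0 b0 0 `&` [set w | ~ lt_pt (lo q w) x].
have mE q : measurable (E q).
  apply: measurableI; first exact: measurable_code.
  apply: (@measurableC _ _ [set w | lt_pt (lo q w) x]).
  by apply: measurable_lt_pt; exact: measurable_lo.
have : (leb (code a0 b0 0 `&` ~` [set w | le_pt (decode w) x]) <=
        (M a0 b0 - M a0 (clamp_pt a0 b0 x))%:E)%E.
  apply: (@le_trans _ _ (leb (\bigcup_q E q))).
    apply: le_measure; rewrite ?inE.
    - apply: measurableI; first exact: measurable_code.
      exact: measurableC.
    - exact: bigcupT_measurable.
    - move=> w [cw /= h]; apply: contrapT => nE; apply: h => i.
      apply: (cvgr_to_le (@decode_cvg w i)); apply: nearW => q.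
      apply: ltW; move: i; apply: contrapT => nlt; apply: nE; exists q => //.
  apply: leb_cvg_le => // [n m nm|q].
    apply/subsetPset => w [cw h]; split=> // h'; apply: h => i.
    exact: le_lt_trans (lo_homo w nm i) (h' i).
  by apply: leb_bisect_nlt => //; exact: le_pt_refl.
move=> h2; have h1 : ((M a0 b0)%:E <=
    leb (code a0 b0 0 `&` [set w | le_pt (decode w) x]) +
    leb (code a0 b0 0 `&` ~` [set w | le_pt (decode w) x]))%E.
  rewrite -(leb_code 0 Mb) -{1}(setIT (code a0 b0 0)).
  rewrite -(setUCr [set w | le_pt (decode w) x]) setIUr.
  apply: measureU2; apply: measurableI => //; try exact: measurable_code.
  exact: measurableC.
rewrite box_measureE; have := le_trans h1 (leeD2l _ h2).
rewrite -[[set w | le_pt (decode w) x]]/(decode @^-1` [set y | le_pt y x]).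
set L := leb _.
have : (L <= (M a0 b0)%:E)%E.
  rewrite -(leb_code 0 Mb); apply: le_measure; rewrite ?inE.
  - by apply: measurableI => //; exact: measurable_code.
  - exact: measurable_code.
  - by move=> w [].
have : (0 <= L)%E by exact: measure_ge0.
case: L => [r| |] //=; rewrite -EFinD !lee_fin; lra.
Qed.

(** The closed orthant at x sits in the open orthant at any y strictly above x. Such a y leaves the
    box when x touches an upper face, hence the clamping. *)
Lemma box_measure_le x : le_pt a0 x -> le_pt x b0 ->
  (forall e, 0 < e -> exists y, lt_pt x y /\ M a0 (clamp_pt a0 b0 y) <= M a0 x + e) ->
  box_measure [set y | le_pt y x] = (M a0 x)%:E.
Proof.
move=> ax xb rc; apply/eqP; rewrite eq_le; apply/andP; split; last first.
  by have := box_measure_ge x; rewrite clamp_pt_id.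
apply/lee_addgt0Pr => e /rc[y [xy ye]].
apply: (@le_trans _ _ (box_measure [set z | lt_pt z y])); last first.
  by apply: (le_trans (box_measure_lt y)); rewrite -EFinD lee_fin.
rewrite !box_measureE; apply: le_measure; rewrite ?inE.
- apply: measurableI; first exact: measurable_code.
  by apply: measurable_le_pt; exact: measurable_decode_tnth.
- apply: measurableI; first exact: measurable_code.
  by apply: measurable_lt_pt; exact: measurable_decode_tnth.
- by move=> w [cw wx]; split=> // i; exact: le_lt_trans (wx i) (xy i).
Qed.

End BisectionMeasure.

(** * Variation of a box function *)

Section Variation.
Variables (R : realType) (d : nat).
Implicit Types (x y a b : d.-tuple R) (l : seq ('I_d * R)).
Variable v : d.-tuple R -> d.-tuple R -> R.
Hypothesis vadd : forall a b i s, v a (upd b i s) + v (upd a i s) b = v a b.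

Definition clamp (p q s : R) := Num.max p (Num.min q s).

Lemma clamp_itv p q s : p <= q -> p <= clamp p q s <= q.
Proof. by move=> pq; rewrite /clamp le_max lexx ge_max pq ge_min lexx. Qed.

Lemma clamp_id p q s : p <= s <= q -> clamp p q s = s.
Proof. by case/andP=> ps sq; rewrite /clamp (min_idPr sq) (max_idPr ps). Qed.

(* The sum of |v| over the cells of the grid obtained from the box (a, b] by
   cutting along the hyperplanes x_i = s with (i, s) in l. *)
Fixpoint cutsum l a b : R :=
  if l is (i, s) :: l' then
    let r := clamp (tnth a i) (tnth b i) s in
    cutsum l' a (upd b i r) + cutsum l' (upd a i r) b
  else `|v a b|.

Lemma cutsum_ge0 l a b : 0 <= cutsum l a b.
Proof. by elim: l a b => [|[i s] l IH] a b //=; rewrite addr_ge0. Qed.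

(** This makes a hyperplane that misses the box harmless: clamping moves it to a face, and it only
    splits off a degenerate box. *)
Lemma cutsum_degen l a b i : tnth a i = tnth b i -> cutsum l a b = 0.
Proof.
elim: l a b => [|[j s] l IH] a b ab /=.
  have := vadd a b i (tnth a i); rewrite upd_id ab upd_id.
  by move=> h; have -> : v a b = 0 by [lra]; rewrite normr0.
have [->|ji] := eqVneq j i.
  have -> : clamp (tnth a i) (tnth b i) s = tnth a i.
    by rewrite /clamp ab; apply/max_idPl; rewrite ge_min lexx.
  by rewrite !IH ?addr0 // ?tnth_upd ?eqxx.
by rewrite !IH ?addr0 // tnth_upd eq_sym (negPf ji).
Qed.

(** An extra cut refines, by the triangle inequality on the final cells. Cuts in different
    directions commute; for two cuts in the same direction, the older one falls in one half and
    clamps to a face of the other, where it adds a nonnegative term. *)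
Lemma cutsum_split l a b j r : le_pt a b -> tnth a j <= r <= tnth b j ->
  cutsum l a b <= cutsum l a (upd b j r) + cutsum l (upd a j r) b.
Proof.
elim: l a b j r => [|[i s] l IH] a b j r ab /andP[ar rb].
  by rewrite /= -(vadd a b j r) ler_normD.
rewrite /=; have /andP[r1 r2] := clamp_itv s (ab i).
have [ij|ij] := eqVneq i j; last first.
  rewrite !tnth_upd (negPf ij).
  set t := clamp _ _ _ in r1 r2 *.
  have := IH a (upd b i t) j r; have := IH (upd a i t) b j r.
  rewrite !tnth_upd eq_sym (negPf ij) ar rb => /(_ _ isT) h1 /(_ _ isT) h2.
  have := h1 (le_pt_updl ab r2); have := h2 (le_pt_updr ab r1).
  rewrite !(upd_comm _ _ _ ij); lra.
subst j; rewrite !tnth_upd eqxx !upd_upd.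
set t := clamp _ _ _ in r1 r2 *.
have [rt|/ltW tr] := leP r t.
  have -> : clamp (tnth a i) r s = r.
    by move: rt r1 r2; rewrite /t /clamp !maxEle !minEle; repeat case: ifP => //; lra.
  have -> : clamp r (tnth b i) s = t.
    by move: rt r1 r2; rewrite /t /clamp !maxEle !minEle; repeat case: ifP => //; lra.
  have := IH a (upd b i t) i r (le_pt_updr ab r1).
  rewrite tnth_upd eqxx ar rt => /(_ isT); rewrite upd_upd => h.
  have := cutsum_ge0 l (upd a i r) (upd b i r); lra.
have -> : clamp (tnth a i) r s = t.
  by move: tr r1 r2; rewrite /t /clamp !maxEle !minEle; repeat case: ifP => //; lra.
have -> : clamp r (tnth b i) s = r.
  by move: tr r1 r2; rewrite /t /clamp !maxEle !minEle; repeat case: ifP => //; lra.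
have := IH (upd a i t) b i r (le_pt_updl ab r2).
rewrite tnth_upd eqxx tr rb => /(_ isT); rewrite upd_upd => h.
have := cutsum_ge0 l (upd a i r) (upd b i r); lra.
Qed.

Lemma cutsum_consE l a b i r : tnth a i <= r <= tnth b i ->
  cutsum ((i, r) :: l) a b = cutsum l a (upd b i r) + cutsum l (upd a i r) b.
Proof. by move=> abr; rewrite /= clamp_id. Qed.

Lemma cutsum_catr l1 l2 a b : le_pt a b -> cutsum l2 a b <= cutsum (l1 ++ l2) a b.
Proof.
elim: l1 a b => [|[i s] l IH] a b ab //=.
have r12 := clamp_itv s (ab i); apply: (le_trans (cutsum_split l2 ab r12)).
case/andP: r12 => r1 r2.
by apply: lerD; apply: IH; [exact: le_pt_updr|exact: le_pt_updl].
Qed.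

Lemma cutsum_catl l1 l2 a b : le_pt a b -> cutsum l1 a b <= cutsum (l1 ++ l2) a b.
Proof.
elim: l1 a b => [|[i s] l IH] a b ab.
  by have := cutsum_catr l2 [::] ab; rewrite cats0.
rewrite /=; have /andP[r1 r2] := clamp_itv s (ab i).
by apply: lerD; apply: IH; [exact: le_pt_updr|exact: le_pt_updl].
Qed.

(** A real supremum, meaningful once the set is bounded; boundedness on (a0, b0] passes to sub-boxes
    by [box_ind], since a cut of the box bounds the sums on each half. *)
Definition box_variation a b : R := sup (range (fun l => cutsum l a b)).

Section Bounded.
Variables (a0 b0 : d.-tuple R) (C : R).
Hypothesis a0b0 : le_pt a0 b0.
Hypothesis cutsum_bound : forall l, cutsum l a0 b0 <= C.

Let has_sup_cutsum a b : le_pt a0 a -> le_pt a b -> le_pt b b0 ->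
  has_sup (range (fun l => cutsum l a b)).
Proof.
move=> a0a ab bb0; split; first by exists (cutsum [::] a b), [::].
move: a b a0a ab bb0; apply: box_ind; last by exists C => _ [l _ <-].
move=> a b i r a0a ab bb0 ri [K KP]; split; exists K => _ [l _ <-].
  apply: le_trans (KP (cutsum ((i, r) :: l) a b) _); last by exists ((i, r) :: l).
  by rewrite cutsum_consE // lerDl cutsum_ge0.
apply: le_trans (KP (cutsum ((i, r) :: l) a b) _); last by exists ((i, r) :: l).
by rewrite cutsum_consE // lerDr cutsum_ge0.
Qed.

Lemma cutsum_le_variation l a b : le_pt a0 a -> le_pt a b -> le_pt b b0 ->
  cutsum l a b <= box_variation a b.
Proof.
by move=> a0a ab bb0; apply: ub_le_sup; [case: (has_sup_cutsum a0a ab bb0)|exists l].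
Qed.

Lemma box_variation_le a b K : (forall l, cutsum l a b <= K) -> box_variation a b <= K.
Proof.
move=> h; apply: ge_sup; first by exists (cutsum [::] a b), [::].
by move=> _ [l _ <-].
Qed.

(** Lists for the two halves are concatenated after the cut [(i, r)]; each half then sees a
    refinement of its own list, which gives superadditivity. The converse is [cutsum_split]. *)
Lemma box_variation_add a b i r : le_pt a0 a -> le_pt a b -> le_pt b b0 ->
  tnth a i <= r <= tnth b i ->
  box_variation a (upd b i r) + box_variation (upd a i r) b = box_variation a b.
Proof.
move=> a0a ab bb0 /[dup] ri /andP[r1 r2].
have l1 : le_pt a (upd b i r) by exact: le_pt_updr.
have l2 : le_pt (upd a i r) b by exact: le_pt_updl.
have l3 : le_pt (upd b i r) b0.
  by apply: le_pt_updl => //; exact: le_trans r2 (bb0 i).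
have l4 : le_pt a0 (upd a i r).
  by apply: le_pt_updr => //; exact: le_trans (a0a i) r1.
apply/eqP; rewrite eq_le; apply/andP; split.
  rewrite -lerBrDr; apply: box_variation_le => l1'.
  rewrite lerBrDr -lerBrDl; apply: box_variation_le => l2'; rewrite lerBrDl.
  apply: le_trans (cutsum_le_variation ((i, r) :: l1' ++ l2') a0a ab bb0).
  by rewrite cutsum_consE // lerD // ?cutsum_catl ?cutsum_catr.
apply: box_variation_le => l; apply: (le_trans (cutsum_split l ab ri)).
by rewrite lerD // cutsum_le_variation.
Qed.

Lemma normr_le_variation a b : le_pt a0 a -> le_pt a b -> le_pt b b0 ->
  `|v a b| <= box_variation a b.
Proof. exact: (cutsum_le_variation [::]). Qed.

Lemma box_variation_ge0 a b : le_pt a0 a -> le_pt a b -> le_pt b b0 ->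
  0 <= box_variation a b.
Proof. by move=> *; apply: le_trans (normr_le_variation _ _ _). Qed.

Hypothesis v_rc : forall a b i e, 0 < e -> exists2 h, 0 < h &
  forall t, 0 < t < h -> `|v a (upd b i (tnth a i + t))| <= e.

(** A thin enough strip above a_i avoids every cut x_i = s with s > a_i, while those with s <= a_i
    degenerate; cuts in other directions divide it into finitely many strips, each treated by
    [v_rc]. *)
Lemma cutsum_rc l a b i e : 0 < e -> exists2 h, 0 < h &
  forall t, 0 < t < h -> cutsum l a (upd b i (tnth a i + t)) <= e.
Proof.
elim: l a b e => [|[j s] l IH] a b e e0; first exact: v_rc.
have [->|ij] := eqVneq j i; last first.
  have e2 : 0 < e / 2 by lra.
  set r := clamp (tnth a j) (tnth b j) s.
  have [h1 h10 H1] := IH a (upd b j r) _ e2.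
  have [h2 h20 H2] := IH (upd a j r) b _ e2.
  exists (Num.min h1 h2) => [|t /andP[t0]]; first by rewrite lt_min h10.
  rewrite lt_min => /andP[th1 th2]; rewrite /= !tnth_upd (negPf ij) -/r.
  have := H1 t; have := H2 t; rewrite t0 th1 th2 => /(_ isT) k2 /(_ isT) k1.
  rewrite (upd_comm _ _ _ ij) in k1; move: k1 k2.
  by rewrite tnth_upd eq_sym (negPf ij); lra.
have [h h0 H] := IH a b _ e0.
have [sa|sa] := leP s (tnth a i).
  exists h => // t ht /=; rewrite tnth_upd eqxx.
  have -> : clamp (tnth a i) (tnth a i + t) s = tnth a i.
    rewrite /clamp; apply/max_idPl; rewrite ge_min sa orbT //.
  rewrite upd_upd upd_id (cutsum_degen l (i := i)) ?add0r ?H //.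
  by rewrite tnth_upd eqxx.
exists (Num.min h (s - tnth a i)) => [|t /andP[t0]].
  by rewrite lt_min h0 subr_gt0.
rewrite lt_min => /andP[th ts] /=; rewrite tnth_upd eqxx.
have -> : clamp (tnth a i) (tnth a i + t) s = tnth a i + t.
  by rewrite /clamp; rewrite (min_idPl _) ?(max_idPr _); lra.
rewrite upd_upd (cutsum_degen l (a := upd a i _) (i := i)) ?addr0 ?H ?t0 //.
by rewrite !tnth_upd eqxx.
Qed.

(** Take cuts whose sum is within e/2 of the variation. What they miss on the strip they miss on the
    whole box, so the variation of the strip exceeds its cut sum by at most e/2, and that sum is at
    most e/2 by [cutsum_rc]. *)
Lemma box_variation_strip a b i e : le_pt a0 a -> le_pt a b -> le_pt b b0 ->
  tnth a i < tnth b i -> 0 < e -> exists t, [/\ 0 < t, tnth a i + t <= tnth b i &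
    box_variation a (upd b i (tnth a i + t)) <= e].
Proof.
move=> a0a ab bb0 abi e0; have e2 : 0 < e / 2 by lra.
have [_ [l _ <-] lV] := sup_adherent e2 (has_sup_cutsum a0a ab bb0).
have [h h0 H] := cutsum_rc l a b i e2.
pose t := Num.min (h / 2) (tnth b i - tnth a i).
have t0 : 0 < t by rewrite lt_min; apply/andP; split; lra.
have tb : t <= tnth b i - tnth a i by rewrite ge_min lexx orbT.
have th : t < h by have : t <= h / 2 by [rewrite ge_min lexx]; lra.
exists t; split => //; first lra.
have ri : tnth a i <= tnth a i + t <= tnth b i by lra.
have := box_variation_add a0a ab bb0 ri; have := cutsum_split l ab ri.
have := H t; rewrite t0 th => /(_ isT).
have : cutsum l (upd a i (tnth a i + t)) b <= box_variation (upd a i (tnth a i + t)) b.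
  apply: cutsum_le_variation => //.
    apply: le_pt_updr => //; have := a0a i; lra.
  by apply: le_pt_updl => //; lra.
by move: lV; rewrite -/(box_variation a b); lra.
Qed.

(** The corner moves from x to z one coordinate at a time. Each move adds a box contained in a thin
    strip across all of (a0, b0], whose variation is at most e'. *)
Lemma box_variation_rc x e : le_pt a0 x -> le_pt x b0 -> 0 < e ->
  exists y, lt_pt x y /\ box_variation a0 (clamp_pt a0 b0 y) <= box_variation a0 x + e.
Proof.
(* At most d strips are added; [d.+1] keeps the quotient meaningful in dimension 0. *)
move=> ax xb e0; pose e' := e / d.+1%:R.
have e'0 : 0 < e' by rewrite divr_gt0.
have /choice[t tP] : forall i, exists t, 0 < t /\ (tnth x i < tnth b0 i ->
    tnth x i + t <= tnth b0 i /\
    box_variation (upd a0 i (tnth x i)) (upd b0 i (tnth x i + t)) <= e').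
  move=> i; have [xbi|xbi] := ltP (tnth x i) (tnth b0 i); last first.
    by exists 1; rewrite ltr01; split.
  have aui : tnth (upd a0 i (tnth x i)) i = tnth x i by rewrite tnth_upd eqxx.
  have [|||||t [t0 tb tV]] := @box_variation_strip (upd a0 i (tnth x i)) b0 i e'.
  - by apply: le_pt_updr => //; exact: le_pt_refl.
  - exact: le_pt_updl.
  - exact: le_pt_refl.
  - by rewrite aui.
  - exact: e'0.
  by move: tb tV; rewrite aui => tb tV; exists t.
pose y : d.-tuple R := [tuple tnth x i + t i | i < d].
have yE i : tnth y i = tnth x i + t i by rewrite tnth_mktuple.
exists y; split; first by move=> i; rewrite yE ltrDl; case: (tP i).
set z := clamp_pt a0 b0 y.
have zb : le_pt z b0 by exact: clamp_pt_le.
have xz : le_pt x z.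
  move=> i; rewrite tnth_mktuple le_max le_min xb yE lerDl.
  by case: (tP i) => /ltW -> _; rewrite orbT.
have zE i : (tnth x i < tnth b0 i /\ tnth z i = tnth x i + t i) \/ tnth z i = tnth x i.
  have [xbi|xbi] := ltP (tnth x i) (tnth b0 i); [left|right].
    split=> //; have [t0 /(_ xbi)[tb _]] := tP i.
    by rewrite tnth_mktuple yE (min_idPr tb) (max_idPr _) //; have := ax i; lra.
  by apply/eqP; rewrite eq_le xz andbT (le_trans (zb i)).
pose zs (s : seq 'I_d) : d.-tuple R :=
  [tuple if i \in s then tnth z i else tnth x i | i < d].
suff H s : box_variation a0 (zs s) <= box_variation a0 x + (size s)%:R * e'.
  have -> : z = zs (enum 'I_d).
    by apply: eq_from_tnth => i; rewrite [RHS]tnth_mktuple mem_enum.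
  apply: (le_trans (H _)); rewrite lerD2l size_enum_ord /e' mulrCA ger_pMr //.
  by rewrite ler_pdivrMr // mul1r ler_nat.
have xzs s' : le_pt x (zs s').
  by move=> i; rewrite tnth_mktuple; case: ifP => // _; exact: xz.
have zsz s' : le_pt (zs s') z.
  by move=> i; rewrite tnth_mktuple; case: ifP => // _; exact: xz.
elim: s => [|i s IH].
  rewrite mul0r addr0 (_ : zs [::] = x) //.
  by apply: eq_from_tnth => i; rewrite tnth_mktuple.
have zi : tnth (zs (i :: s)) i = tnth z i by rewrite tnth_mktuple mem_head.
have [is_|is_] := boolP (i \in s).
  have -> : zs (i :: s) = zs s.
    apply: eq_from_tnth => j; rewrite !tnth_mktuple in_cons.
    by have [->|] := eqVneq j i; rewrite ?is_.
  by apply: (le_trans IH); rewrite lerD2l ler_wpM2r ?ler_nat // ltW.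
have a0zs : le_pt a0 (zs (i :: s)) := le_pt_trans ax (xzs _).
have zsb : le_pt (zs (i :: s)) b0 := le_pt_trans (zsz _) zb.
rewrite -(box_variation_add (i := i) (r := tnth x i) _ a0zs zsb) //; last first.
  by rewrite ax zi xz.
have -> : upd (zs (i :: s)) i (tnth x i) = zs s.
  apply: eq_from_tnth => j; rewrite tnth_upd !tnth_mktuple in_cons.
  by have [->|] := eqVneq j i; rewrite ?(negPf is_).
have e'i : box_variation (upd a0 i (tnth x i)) (zs (i :: s)) <= e'.
  have l1 : le_pt a0 (upd a0 i (tnth x i)).
    by apply: le_pt_updr => //; exact: le_pt_refl.
  have l2 : le_pt (upd a0 i (tnth x i)) (zs (i :: s)).
    by apply: le_pt_updl => //; rewrite zi.
  case: (zE i) => [[xbi zti]|zxi].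
    have [_ /(_ xbi)[tb tV]] := tP i; apply: le_trans tV.
    apply: (@box_fun_mono _ _ a0 b0 box_variation box_variation_add box_variation_ge0) => //.
    - by move=> j; rewrite tnth_upd; case: eqP => [->|_]; rewrite ?zi ?zti.
    - by apply: le_pt_updl => //; exact: le_pt_refl.
  rewrite (@box_fun_degen _ _ a0 b0 box_variation box_variation_add _ _ i) // ?ltW //.
  by rewrite tnth_upd eqxx zi.
by rewrite -natr1 mulrDl mul1r; lra.
Qed.

Lemma signed_box_measures :
  exists m1 m2 : {finite_measure set (d.-tuple R) -> \bar R},
  [/\ forall x, le_pt a0 x -> le_pt x b0 ->
        m1 [set y | le_pt y x] = ((box_variation a0 x + v a0 x) / 2)%:E,
      forall x, le_pt a0 x -> le_pt x b0 ->
        m2 [set y | le_pt y x] = ((box_variation a0 x - v a0 x) / 2)%:E,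
      m1 setT = ((box_variation a0 b0 + v a0 b0) / 2)%:E &
      m2 setT = ((box_variation a0 b0 - v a0 b0) / 2)%:E].
Proof.
pose M1 a b := (box_variation a b + v a b) / 2.
pose M2 a b := (box_variation a b - v a b) / 2.
have M1add a b i r : le_pt a0 a -> le_pt a b -> le_pt b b0 ->
  tnth a i <= r <= tnth b i -> M1 a (upd b i r) + M1 (upd a i r) b = M1 a b.
  move=> h1 h2 h3 h4; rewrite /M1 -(box_variation_add h1 h2 h3 h4) -(vadd a b i r); lra.
have M2add a b i r : le_pt a0 a -> le_pt a b -> le_pt b b0 ->
  tnth a i <= r <= tnth b i -> M2 a (upd b i r) + M2 (upd a i r) b = M2 a b.
  move=> h1 h2 h3 h4; rewrite /M2 -(box_variation_add h1 h2 h3 h4) -(vadd a b i r); lra.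
have M1ge0 a b : le_pt a0 a -> le_pt a b -> le_pt b b0 -> 0 <= M1 a b.
  move=> h1 h2 h3; have := normr_le_variation h1 h2 h3.
  by rewrite ler_norml /M1; lra.
have M2ge0 a b : le_pt a0 a -> le_pt a b -> le_pt b b0 -> 0 <= M2 a b.
  move=> h1 h2 h3; have := normr_le_variation h1 h2 h3.
  by rewrite ler_norml /M2; lra.
have xz x y : le_pt a0 x -> le_pt x b0 -> lt_pt x y -> le_pt x (clamp_pt a0 b0 y).
  move=> ax xb xy i; rewrite tnth_mktuple le_max le_min xb.
  by rewrite (ltW (xy i)) orbT.
exists (box_measure a0b0 M1ge0), (box_measure a0b0 M2ge0); split.
(* The variation is [M1 + M2] with [M2] monotone, so [M1] grows by no more than the variation
   does. *)
- move=> x ax xb; apply: box_measure_le => // e e0.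
  have [y [xy yV]] := box_variation_rc ax xb e0; exists y; split=> //.
  have := box_fun_mono M2add M2ge0 (@le_pt_refl _ _ a0) (@le_pt_refl _ _ a0) ax
    (xz _ _ ax xb xy) (clamp_pt_le y a0b0).
  by rewrite /M2 /M1; lra.
- move=> x ax xb; apply: box_measure_le => // e e0.
  have [y [xy yV]] := box_variation_rc ax xb e0; exists y; split=> //.
  have := box_fun_mono M1add M1ge0 (@le_pt_refl _ _ a0) (@le_pt_refl _ _ a0) ax
    (xz _ _ ax xb xy) (clamp_pt_le y a0b0).
  by rewrite /M2 /M1; lra.
- exact: box_measureT.
- exact: box_measureT.
Qed.

End Bounded.
End Variation.

(** * Extension across the lower faces *)

Section Extension.
Variables (R : realType) (d : nat).
Implicit Types (f g : d.-tuple R -> R) (x y a b c : d.-tuple R) (u : {set 'I_d}).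

(** Freezing f beyond the upper faces makes its extension right-continuous at these faces as
    well. *)
Definition clip x : d.-tuple R := [tuple Num.min (tnth x i) 1 | i < d].

(* Extending f by zero across the lower faces of the cube turns its values, and
   its quasi-volumes on all the lower faces, into d-dimensional quasi-volumes. *)
Definition ext f x : R := if [forall i, 0 <= tnth x i] then f (clip x) else 0.

Definition ptN1 : d.-tuple R := [tuple -1 | i < d].

Definition bvol f a b := qvol (ext f) [set: 'I_d]%SET (pt0 R d) a b.

Lemma clip_in01 x : in01 x -> clip x = x.
Proof.
move=> x01; apply: eq_from_tnth => i; rewrite tnth_mktuple.
by apply/min_idPl; case/andP: (x01 i).
Qed.

Lemma ext_in01 f x : in01 x -> ext f x = f x.
Proof.
move=> x01; rewrite /ext clip_in01 //.
by rewrite (introT forallP) // => i; case/andP: (x01 i).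
Qed.

Lemma ext_neg f x i : tnth x i < 0 -> ext f x = 0.
Proof.
move=> xi; rewrite /ext; case: forallP => // /(_ i).
by rewrite leNgt xi.
Qed.

Lemma tnth_vertex (J u : {set 'I_d}) a b c j :
  tnth [tuple (if i \in J then tnth a i else if i \in u then tnth b i
               else tnth c i) | i < d] j =
  if j \in J then tnth a j else if j \in u then tnth b j else tnth c j.
Proof. by rewrite tnth_mktuple. Qed.

Lemma bvol_cut f a b i s : bvol f a (upd b i s) + bvol f (upd a i s) b = bvol f a b.
Proof. by apply: qvol_cut; rewrite finset.in_setT. Qed.

Lemma bvol_degen f a b i : tnth a i = tnth b i -> bvol f a b = 0.
Proof. by apply: qvol_degen; rewrite finset.in_setT. Qed.

Lemma bvol_neg f a b i : tnth a i < 0 -> tnth b i < 0 -> bvol f a b = 0.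
Proof.
move=> ai bi; apply: big1 => J _; rewrite (@ext_neg _ _ i) ?mulr0 //.
by rewrite tnth_vertex finset.in_setT; case: ifP.
Qed.

Lemma bvolD f g a b : bvol (fun x => f x + g x) a b = bvol f a b + bvol g a b.
Proof.
rewrite /bvol -qvolD; apply: eq_qvol => J _ /=.
by rewrite /ext; case: ifP; rewrite ?addr0.
Qed.

Lemma bvolN f a b : bvol (fun x => - f x) a b = - bvol f a b.
Proof.
rewrite /bvol -qvolN; apply: eq_qvol => J _ /=.
by rewrite /ext; case: ifP; rewrite ?oppr0.
Qed.

(** Every vertex other than x has a coordinate -1, where the extension vanishes; f is thus the
    distribution function of [bvol f]. *)
Lemma bvol_N1 f x : bvol f ptN1 x = ext f x.
Proof.
rewrite /bvol /qvol (bigD1 finset.set0) ?powersetE ?finset.sub0set //=.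
rewrite cards0 expr0 mul1r [X in _ + X]big1 ?addr0 => [|J /andP[_ /set0Pn[i iJ]]].
  congr (ext f); apply: eq_from_tnth => i.
  by rewrite tnth_vertex finset.in_setT finset.in_set0.
by rewrite (@ext_neg _ _ i) ?mulr0 // tnth_vertex iJ tnth_mktuple ltrN10.
Qed.

(** Vertices that take some negative a_i contribute 0, so the coordinates off [u] are fixed at b_i
    and a quasi-volume over [u] remains. *)
Lemma bvol_faceE f u a b :
  (forall i, (i \in u) = (0 <= tnth a i)) -> (forall i, 0 <= tnth b i) ->
  bvol f a b = qvol f u (clip b) (clip a) (clip b).
Proof.
move=> ua b0; rewrite /bvol /qvol.
rewrite (bigID (fun J : {set 'I_d} => J \subset u)) /= [X in _ + X]big1; last first.
  move=> J /andP[_ /subsetPn[i iJ]]; rewrite ua -ltNge => ai.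
  by rewrite (@ext_neg _ _ i) ?mulr0 // tnth_vertex iJ.
rewrite addr0; apply: eq_big => [J|J /andP[_ Ju]].
  by rewrite !powersetE finset.subsetT.
congr (_ * _); rewrite /ext (introT forallP) => [|i]; last first.
  rewrite tnth_vertex finset.in_setT; case: ifPn => // iJ.
  by rewrite -ua (fintype.subsetP Ju).
congr f; apply: eq_from_tnth => i; rewrite tnth_vertex tnth_mktuple tnth_vertex.
rewrite finset.in_setT [in RHS]if_same !tnth_mktuple.
by case: ifP.
Qed.

Lemma eq_qvol_pts f u c a b c' a' b' :
  (forall i, i \in u -> tnth a i = tnth a' i /\ tnth b i = tnth b' i) ->
  (forall i, i \notin u -> tnth c i = tnth c' i) ->
  qvol f u c a b = qvol f u c' a' b'.
Proof.
move=> ab cc; apply: eq_bigr => J; rewrite powersetE => /fintype.subsetP Ju.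
congr (_ * f _); apply: eq_from_tnth => i; rewrite !tnth_vertex.
case: (boolP (i \in J)) => [/Ju/ab[-> _] //|_].
by case: (boolP (i \in u)) => [/ab[]|/cc].
Qed.

Lemma bvol_face f u a b :
  (forall i, i \in u -> 0 <= tnth a i <= 1 /\ 0 <= tnth b i <= 1) ->
  (forall i, i \notin u -> tnth a i < 0 /\ tnth b i = 0) ->
  bvol f a b = qvol f u (pt0 R d) a b.
Proof.
move=> ab1 ab0; rewrite (@bvol_faceE f u).
- apply: eq_qvol_pts => i iu; rewrite !tnth_mktuple.
    by have [/andP[_ a1] /andP[_ b1]] := ab1 _ iu; rewrite !(min_idPl _).
  by have [_ ->] := ab0 _ iu; apply/min_idPl.
- move=> i; apply/idP/idP => [/ab1[/andP[]] //|].
  by apply: contraTT => /ab0[]; rewrite -ltNge.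
- move=> i; have [/ab1[_ /andP[]] //|/ab0[_ ->]] := boolP (i \in u).
  exact: lexx.
Qed.

(** [completely_monotone] constrains all coordinates of the corners; those off [u] do not affect the
    quasi-volume and are reset to 0. *)
Lemma cm_qvol_ge0 g u c a b : completely_monotone g -> (0 < #|u|)%N -> in01 c ->
  (forall i, i \in u -> 0 <= tnth a i <= tnth b i /\ tnth b i <= 1) ->
  0 <= qvol g u c a b.
Proof.
move=> cm u0 c01 ab.
pose z x : d.-tuple R := [tuple if i \in u then tnth x i else 0 | i < d].
rewrite (@eq_qvol_pts _ _ _ _ _ c (z a) (z b)) => [|i iu|//]; last first.
  by rewrite !tnth_mktuple iu.
apply: cm => // i; rewrite !tnth_mktuple; case: ifP => [/ab //|_].
by rewrite lexx ler01.
Qed.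

Lemma pt0_in01 : in01 (pt0 R d).
Proof. by move=> i; rewrite tnth_mktuple lexx ler01. Qed.

Lemma pt1_in01 : in01 (pt1 R d).
Proof. by move=> i; rewrite tnth_mktuple lexx ler01. Qed.

Lemma cm_ge0 g x : completely_monotone g -> 0 <= g (pt0 R d) -> in01 x -> 0 <= g x.
Proof.
move=> cm g0 x01; rewrite -(sum_qvol g (pt0 R d) x).
suff h (u : {set 'I_d}) : 0 <= qvol g u (pt0 R d) (pt0 R d) x by apply: sumr_ge0.
have [/eqP|u0] := posnP #|u|; first by rewrite cards_eq0 => /eqP ->; rewrite qvol0.
apply: cm u0 pt0_in01 _ => i; rewrite tnth_mktuple lexx.
by have /andP[-> ->] := x01 i.
Qed.

Lemma bvol_ge0 g a b : completely_monotone g -> 0 <= g (pt0 R d) ->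
  le_pt a b -> 0 <= bvol g a b.
Proof.
move=> cm g0 ab; have [b0|] := pselect (forall i, 0 <= tnth b i); last first.
  case/existsNP => i /negP; rewrite -ltNge => bi.
  by rewrite (@bvol_neg _ _ _ i) // (le_lt_trans (ab i)).
have cb : in01 (clip b).
  by move=> i; rewrite tnth_mktuple le_min b0 ler01 ge_min lexx orbT.
rewrite (@bvol_faceE g [set i | 0 <= tnth a i]%SET) // => [|i]; last by rewrite inE.
have [/eqP|u0] := posnP #|[set i | 0 <= tnth a i]%SET|.
  by rewrite cards_eq0 => /eqP ->; rewrite qvol0; exact: cm_ge0.
apply: cm_qvol_ge0 => // i; rewrite inE => ai; rewrite !tnth_mktuple.
split; last by rewrite ge_min lexx orbT.
by rewrite !le_min ai ler01 !ge_min ab lexx orbT.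
Qed.

Lemma sum_small (T : Type) (r : seq T) (g : T -> R -> R) :
  (forall q e, 0 < e -> exists2 h, 0 < h & forall t, 0 < t < h -> `|g q t| <= e) ->
  forall e, 0 < e -> exists2 h, 0 < h &
    forall t, 0 < t < h -> `|\sum_(q <- r) g q t| <= e.
Proof.
move=> H; elim: r => [|q r IH] e e0.
  by exists 1 => // t _; rewrite big_nil normr0 ltW.
have e2 : 0 < e / 2 by lra.
have [h1 h10 H1] := H q _ e2; have [h2 h20 H2] := IH _ e2.
exists (Num.min h1 h2) => [|t /andP[t0]]; first by rewrite lt_min h10.
rewrite lt_min => /andP[th1 th2]; rewrite big_cons.
apply: (le_trans (ler_normD _ _)).
by have := H1 t; have := H2 t; rewrite t0 th1 th2 => /(_ isT) k2 /(_ isT) k1; lra.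
Qed.

Lemma ext_rc f x i e : right_continuous01 f -> 0 < e -> exists2 h, 0 < h &
  forall t, 0 < t < h -> `|ext f (upd x i (tnth x i + t)) - ext f x| <= e.
Proof.
move=> rc e0; have [[j ji xj]|xpos] := pselect (exists2 j, j != i & tnth x j < 0).
  exists 1 => // t _; rewrite !(@ext_neg _ _ j) ?subrr ?normr0 ?ltW //.
  by rewrite tnth_upd (negPf ji).
have [xi|xi] := ltP (tnth x i) 0.
  exists (- tnth x i) => [|t /andP[_ th]]; first lra.
  rewrite !(@ext_neg _ _ i) ?subrr ?normr0 ?ltW //.
  by rewrite tnth_upd eqxx; lra.
have x0 j : 0 <= tnth x j.
  have [->//|ji] := eqVneq j i; rewrite leNgt; apply/negP => xj.
  by apply: xpos; exists j.
have extE t : 0 < t -> ext f (upd x i (tnth x i + t)) =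
    f (upd (clip x) i (Num.min (tnth x i + t) 1)).
  move=> t0; rewrite /ext (introT forallP) => [|j].
    by congr f; apply: eq_from_tnth => j; rewrite !(tnth_upd, tnth_mktuple); case: eqP.
  by rewrite tnth_upd; case: eqP => // _; have := x0 i; lra.
have ext0 : ext f x = f (clip x) by rewrite /ext (introT forallP).
have [x1|x1] := ltP (tnth x i) 1; last first.
  exists 1 => // t /andP[t0 _]; rewrite extE // ext0 (_ : upd _ _ _ = clip x).
    by rewrite subrr normr0 ltW.
  apply: eq_from_tnth => j; rewrite tnth_upd; case: eqP => // ->.
  by rewrite tnth_mktuple !(min_idPr _) //; lra.
have c01 : in01 (clip x).
  by move=> j; rewrite tnth_mktuple le_min x0 ler01 ge_min lexx orbT.
have ci : tnth (clip x) i = tnth x i by rewrite tnth_mktuple (min_idPl (ltW x1)).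
have := rc (clip x) i c01; rewrite ci => /(_ x1)/cvgrPdist_le/(_ _ e0).
rewrite near_withinE => -[h h0 H].
have {h0} hpos : 0 < h by exact: h0.
have {}H s : `|tnth x i - s| < h -> tnth x i < s ->
    `|f (clip x) - f (upd (clip x) i s)| <= e by exact: H.
have x1' : 0 < 1 - tnth x i by rewrite subr_gt0.
exists (Num.min h (1 - tnth x i)) => [|t /andP[t0]]; first by rewrite lt_min hpos.
rewrite lt_min => /andP[th t1]; rewrite extE // ext0 distrC.
have -> : Num.min (tnth x i + t) 1 = tnth x i + t.
  by apply/min_idPl; move: t1; rewrite ltrBrDl => /ltW.
apply: H; last by rewrite ltrDl.
by rewrite opprD addrA subrr add0r normrN gtr0_norm.
Qed.

(** The increment over the strip pairs each vertex of its lower facet with the one shifted by t in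
    direction i; every difference is small by [ext_rc], and there are finitely many. *)
Lemma bvol_rc f a b i e : right_continuous01 f -> 0 < e -> exists2 h, 0 < h &
  forall t, 0 < t < h -> `|bvol f a (upd b i (tnth a i + t))| <= e.
Proof.
move=> rc e0; pose u := ([set: 'I_d] :\ i)%SET.
pose z (J : {set 'I_d}) : d.-tuple R :=
  [tuple if j \in J then tnth a j else if j \in u then tnth b j else tnth a j | j < d].
pose g (J : {set 'I_d}) t := if J \subset u then
  (-1) ^+ #|J| * (ext f (upd (z J) i (tnth a i + t)) - ext f (z J)) else 0.
have gsmall J e1 : 0 < e1 -> exists2 h, 0 < h & forall t, 0 < t < h -> `|g J t| <= e1.
  move=> e10; rewrite /g; have [Ju|Ju] := boolP (J \subset u); last first.
    by exists 1 => // t _; rewrite normr0 ltW.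
  have zi : tnth (z J) i = tnth a i.
    by rewrite tnth_mktuple !inE eqxx /= if_same.
  have [h h0 H] := ext_rc (z J) i rc e10; exists h => // t ht.
  by rewrite normrM normr_sign mul1r -zi H.
have [h h0 H] := sum_small (index_enum _) gsmall e0; exists h => // t /H.
congr (`|_| <= _).
have iu : i \notin u by rewrite !inE eqxx.
have := qvol_setU1 (ext f) (pt0 R d) a (upd b i (tnth a i + t)) iu.
rewrite finset.setD1K ?finset.in_setT // => /eqP; rewrite eq_sym -subr_eq eq_sym => /eqP E.
rewrite /bvol E /qvol -sumrB [RHS]big_mkcond /=.
apply: eq_bigr => J _; rewrite /g powersetE; case: ifPn => // Ju.
have iJ : i \notin J by apply: contra iu; exact: (fintype.subsetP Ju).
have vE w : [tuple if j \in J then tnth a j else if j \in u then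
      tnth (upd b i (tnth a i + t)) j else tnth (upd (pt0 R d) i w) j | j < d]
    = upd (z J) i w.
  apply: eq_from_tnth => j; rewrite tnth_vertex !tnth_upd.
  rewrite [tnth (z J) j]tnth_mktuple; have [->|ji] := eqVneq j i.
    by rewrite (negPf iu) (negPf iJ).
  by case: ifP => // _; rewrite !inE ji.
rewrite -mulrBr; congr (_ * (_ - _)); first by rewrite vE tnth_upd eqxx.
rewrite vE; congr (ext f _); apply: eq_from_tnth => j; rewrite tnth_upd.
by case: eqP => // ->; rewrite tnth_mktuple (negPf iJ) (negPf iu).
Qed.

End Extension.

(** * Grids *)

Section Grids.
Variables (R : realType) (d : nat).
Implicit Types (f g : d.-tuple R -> R) (x y a b c : d.-tuple R) (u : {set 'I_d}).
Implicit Types (n : 'I_d -> nat) (t : 'I_d -> nat -> R).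

Lemma cells_widen u n N N' (G : ('I_d -> nat) -> R) : (0 < N <= N')%N ->
  (forall i, i \in u -> (n i <= N)%N) ->
  \sum_(k | @cells d u n N' k) G (fun i => k i) =
  \sum_(k | @cells d u n N k) G (fun i => k i).
Proof.
case: N => // N0 /= NN' nN.
pose h (k : {ffun 'I_d -> 'I_N0.+1}) : {ffun 'I_d -> 'I_N'} :=
  [ffun i => widen_ord NN' (k i)].
pose h' (k : {ffun 'I_d -> 'I_N'}) : {ffun 'I_d -> 'I_N0.+1} :=
  [ffun i => inord (k i)].
have kN k i : @cells d u n N' k -> (k i < N0.+1)%N.
  move=> /forallP/(_ i); case: ifP => iu; last by move=> /eqP ->.
  by move=> /leq_trans; apply; exact: nN.
rewrite (reindex_onto h h') /=; last first.
  move=> k ck; apply/ffunP => i; apply: val_inj.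
  by rewrite !ffunE /= inordK // kN.
apply: eq_big => k.
  rewrite (_ : h' (h k) == k) ?andbT; last first.
    by apply/eqP/ffunP => i; rewrite !ffunE; apply: val_inj; rewrite /= inordK.
  by apply: eq_forallb => i; rewrite ffunE.
by move=> _; congr G; apply/funext => i; rewrite ffunE.
Qed.

Lemma grid_sumE f u c n t N : (0 < #|u|)%N -> grid u n t ->
  (forall i, i \in u -> (n i <= N)%N) ->
  grid_sum f u c n t = \sum_(k | @cells d u n N k)
    `|qvol f u c [tuple t i (k i) | i < d] [tuple t i (k i).+1 | i < d]|.
Proof.
move=> /card_gt0P[j ju] g nN.
pose G k := `|qvol f u c [tuple t i (k i) | i < d] [tuple t i (k i).+1 | i < d]|.
have n0 m : (forall i, i \in u -> (n i <= m)%N) -> (0 < m)%N.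
  by move=> nm; have [nj _ _ _] := g _ ju; exact: leq_trans (nm _ ju).
pose m := \max_(i < d) n i.
have nm i : i \in u -> (n i <= m)%N by move=> _; exact: leq_bigmax.
transitivity (\sum_(k | @cells d u n (maxn m N) k) G (fun i => k i)).
  by apply/esym/cells_widen => //; rewrite n0 // leq_maxl.
by apply: cells_widen => //; rewrite n0 // leq_maxr.
Qed.

Lemma grid_homo u n t i l l' : grid u n t -> i \in u -> (l <= l')%N ->
  (l' <= n i)%N -> t i l <= t i l'.
Proof.
move=> g iu; have [_ _ _ h] := g _ iu.
elim: l' => [|l' IH]; first by rewrite leqn0 => /eqP ->.
rewrite leq_eqVlt => /orP[/eqP -> //|]; rewrite ltnS => ll' l'n.
by apply: le_trans (ltW (h _ l'n)); apply: IH => //; exact: ltnW.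
Qed.

Lemma grid_itv u n t i l : grid u n t -> i \in u -> (l <= n i)%N -> 0 <= t i l <= 1.
Proof.
move=> g iu ln; have [_ t0 t1 _] := g _ iu.
by rewrite -t0 -t1 !(grid_homo g iu).
Qed.

Lemma grid_cell_itv u n t N k i : grid u n t -> @cells d u n N k -> i \in u ->
  0 <= t i (k i) <= t i (k i).+1 /\ t i (k i).+1 <= 1.
Proof.
move=> g /forallP/(_ i) + iu; rewrite iu => kn.
have /andP[-> _] := grid_itv g iu (ltnW kn).
have /andP[_ ->] := grid_itv g iu kn.
by rewrite (grid_homo g iu).
Qed.

Lemma sum_grid f u c n t N : (0 < #|u|)%N -> grid u n t ->
  (forall i, i \in u -> (n i <= N)%N) ->
  \sum_(k | @cells d u n N k)
    qvol f u c [tuple t i (k i) | i < d] [tuple t i (k i).+1 | i < d] =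
  qvol f u c (pt0 R d) (pt1 R d).
Proof.
move=> /card_gt0P[j ju] g nN; rewrite qvol_grid //; last first.
  by have [nj _ _ _] := g _ ju; exact: leq_trans (nN _ ju).
apply: eq_qvol_pts => // i iu; rewrite !tnth_mktuple.
by have [_ -> -> _] := g _ iu.
Qed.

Lemma grid_sum_le f g u c n t : (0 < #|u|)%N -> grid u n t ->
  (forall a b, (forall i, i \in u -> 0 <= tnth a i <= tnth b i /\ tnth b i <= 1) ->
    `|qvol f u c a b| <= qvol g u c a b) ->
  grid_sum f u c n t <= qvol g u c (pt0 R d) (pt1 R d).
Proof.
move=> u0 gr fg; pose m := \max_(i < d) n i.
have nm i : i \in u -> (n i <= m)%N by move=> _; exact: leq_bigmax.
rewrite (grid_sumE f c u0 gr nm) -(sum_grid g c u0 gr nm).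
apply: ler_sum => k ck; apply: fg => i iu; rewrite !tnth_mktuple.
exact: grid_cell_itv gr ck iu.
Qed.

Lemma grid_sum_cm g u c n t : completely_monotone g -> in01 c ->
  (0 < #|u|)%N -> grid u n t ->
  grid_sum g u c n t = qvol g u c (pt0 R d) (pt1 R d).
Proof.
move=> cm c01 u0 gr; pose m := \max_(i < d) n i.
have nm i : i \in u -> (n i <= m)%N by move=> _; exact: leq_bigmax.
rewrite (grid_sumE g c u0 gr nm) -(sum_grid g c u0 gr nm).
apply: eq_bigr => k ck; rewrite ger0_norm //; apply: cm_qvol_ge0 => // i iu.
rewrite !tnth_mktuple; exact: grid_cell_itv gr ck iu.
Qed.

Lemma grid_exists u : exists n t, grid u n t.
Proof.
exists (fun=> 1%N), (fun _ l => l%:R) => i _; split=> // l _.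
by rewrite ltr_nat.
Qed.

Lemma vitali_var_le f u c (C : \bar R) :
  (forall n t, grid u n t -> ((grid_sum f u c n t)%:E <= C)%E) ->
  (vitali_var f u c <= C)%E.
Proof. by move=> h; apply: ub_ereal_sup => _ [n [t [g ->]]]; exact: h. Qed.

Lemma grid_sum_le_vitali f u c n t : grid u n t ->
  ((grid_sum f u c n t)%:E <= vitali_var f u c)%E.
Proof. by move=> g; apply: ereal_sup_ubound; exists n, t. Qed.

Lemma grid_sum_ge0 f u c n t : 0 <= grid_sum f u c n t.
Proof. by apply: sumr_ge0 => k _; exact: normr_ge0. Qed.

Lemma vitali_var_ge0 f u c : (0 <= vitali_var f u c)%E.
Proof.
have [n [t g]] := grid_exists u.
by apply: le_trans (grid_sum_le_vitali f c g); rewrite lee_fin grid_sum_ge0.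
Qed.

(** The absolute values disappear, so every grid sum telescopes to the same number. *)
Lemma vitali_var_cm g u c : completely_monotone g -> in01 c -> (0 < #|u|)%N ->
  vitali_var g u c = (qvol g u c (pt0 R d) (pt1 R d))%:E.
Proof.
move=> cm c01 u0; apply/eqP; rewrite eq_le; apply/andP; split.
  by apply: vitali_var_le => n t gr; rewrite grid_sum_cm.
have [n [t gr]] := grid_exists u; rewrite -(grid_sum_cm cm c01 u0 gr).
exact: grid_sum_le_vitali.
Qed.

Lemma eq_vitali_var f u c c' : (forall i, i \notin u -> tnth c i = tnth c' i) ->
  vitali_var f u c = vitali_var f u c'.
Proof.
move=> cc; congr ereal_sup; apply/seteqP.
by split=> _ [n [t [g ->]]]; exists n, t; split=> //; congr EFin;
  apply: eq_bigr => k _; congr (`|_|); apply: eq_qvol_pts => // i /cc.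
Qed.

(** The quasi-volume of a cell on the face x_i = 0 is the one on x_i = 1 minus that of the cell
    thickened to [0,1] in direction i. Used once per coordinate, this moves the anchor from 1 to
    0. *)
Lemma vitali_var_anchor f u c i : i \notin u -> (0 < #|u|)%N ->
  (vitali_var f u (upd c i 0%R) <=
   vitali_var f u (upd c i 1%R) + vitali_var f (i |: u) c)%E.
Proof.
move=> iu u0; apply: vitali_var_le => n t g.
(* A single cell in direction i: its index must be 0, just as for a coordinate off [u], so both
   grids have the same index set. *)
pose n' j := if j == i then 1%N else n j.
pose t' j l := if j == i then l%:R else t j l.
have g' : grid (i |: u) n' t'.
  move=> j; rewrite !inE /n' /t'; case: eqP => [_ _|_ /= /g //].
  by split=> // l _; rewrite ltr_nat.
have u'0 : (0 < #|i |: u|)%N by rewrite cardsU1 iu.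
have := leeD (grid_sum_le_vitali f (upd c i 1) g) (grid_sum_le_vitali f c g').
apply: le_trans; rewrite -EFinD lee_fin.
pose N := (\max_(j < d) n j).+1.
have nN j : j \in u -> (n j <= N)%N.
  by move=> _; apply: leqW; exact: leq_bigmax.
have n'N j : j \in i |: u -> (n' j <= N)%N.
  by rewrite /n'; case: eqP => // _ _; apply: leqW; exact: leq_bigmax.
rewrite !(grid_sumE f _ u0 g nN) (grid_sumE f _ u'0 g' n'N).
rewrite [X in _ <= _ + X](eq_bigl (fun k => @cells d u n N k)) => [|k].
  rewrite -big_split /=; apply: ler_sum => k ck.
  have ki : k i = 0%N :> nat.
    by move/forallP: ck => /(_ i); rewrite (negPf iu) => /eqP.
  pose a : d.-tuple R := [tuple t' j (k j) | j < d].
  pose b : d.-tuple R := [tuple t' j (k j).+1 | j < d].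
  have e s : qvol f u (upd c i s) [tuple t j (k j) | j < d] [tuple t j (k j).+1 | j < d]
     = qvol f u (upd c i s) a b.
    apply: eq_qvol_pts => // j ju; rewrite !tnth_mktuple /t'.
    by case: eqP ju iu => [-> ->|].
  rewrite !e -/a -/b; have := qvol_setU1 f c a b iu.
  have -> : tnth a i = 0 by rewrite tnth_mktuple /t' eqxx ki.
  have -> : tnth b i = 1 by rewrite tnth_mktuple /t' eqxx ki.
  move=> <-; rewrite -[X in `|X| <= _](addKr (qvol f (i |: u) c a b)) addrC.
  by rewrite (le_trans (ler_normD _ _)) // normrN.
apply: eq_forallb => j; rewrite !inE /n'.
by have [->|//] := eqVneq j i; rewrite /= (negPf iu) ltnS leqn0.
Qed.

Lemma vitali_var_anchor0 f :
  (forall u, (0 < #|u|)%N -> (vitali_var f u (pt1 R d) < +oo)%E) ->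
  forall u, (0 < #|u|)%N -> (vitali_var f u (pt0 R d) < +oo)%E.
Proof.
move=> H; pose mx (s : seq 'I_d) : d.-tuple R :=
  [tuple if i \in s then 0 else 1 | i < d].
suff K s u : (0 < #|u|)%N -> (vitali_var f u (mx s) < +oo)%E.
  have -> : pt0 R d = mx (enum 'I_d); last exact: K.
  by apply: eq_from_tnth => i; rewrite !tnth_mktuple mem_enum.
elim: s u => [|i s IH] u u0.
  have -> : mx [::] = pt1 R d; last exact: H.
  by apply: eq_from_tnth => i; rewrite !tnth_mktuple.
have [is_|is_] := boolP (i \in s).
  have -> : mx (i :: s) = mx s; last exact: IH.
  apply: eq_from_tnth => j; rewrite !tnth_mktuple in_cons.
  by have [->|] := eqVneq j i; rewrite ?is_.
have [iu|iu] := boolP (i \in u).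
  rewrite (@eq_vitali_var _ _ _ (mx s)) ?IH // => j ju.
  rewrite !tnth_mktuple in_cons; have [ji|//] := eqVneq j i.
  by rewrite ji iu in ju.
have -> : mx (i :: s) = upd (mx s) i 0.
  apply: eq_from_tnth => j; rewrite !tnth_mktuple in_cons.
  by have [->|] := eqVneq j i.
apply: le_lt_trans (vitali_var_anchor f (mx s) iu u0) _.
rewrite lte_add_pinfty //; last by rewrite IH // cardsU1 iu.
rewrite (_ : upd _ _ _ = mx s) ?IH //.
apply: eq_from_tnth => j; rewrite !tnth_mktuple.
by have [->|] := eqVneq j i; rewrite ?(negPf is_).
Qed.

End Grids.

(** * Comparison of hyperplane cuts with grids on the lower faces *)

Section CutsGrid.
Variables (R : realType) (d : nat).
Implicit Types (f g : d.-tuple R -> R) (x y a b c : d.-tuple R) (u : {set 'I_d}).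
Implicit Types (n : 'I_d -> nat) (t : 'I_d -> nat -> R) (l : seq ('I_d * R)).

Lemma clamp_cutl (p q s z : R) : p <= q -> z <= s ->
  clamp p (clamp p q s) z = clamp p q z /\ clamp (clamp p q s) q z = clamp p q s.
Proof.
move=> pq zs; rewrite /clamp !maxEle !minEle.
by split; repeat case: ifP => //; lra.
Qed.

Lemma clamp_cutr (p q s z : R) : p <= q -> s <= z ->
  clamp p (clamp p q s) z = clamp p q s /\ clamp (clamp p q s) q z = clamp p q z.
Proof.
move=> pq zs; rewrite /clamp !maxEle !minEle.
by split; repeat case: ifP => //; lra.
Qed.

(** Each cut leaves each grid interval whole on one side. *)
Definition cut_compat l n t := forall i s, (i, s) \in l -> forall k, (k < n i)%N ->
  s <= t i k \/ t i k.+1 <= s.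

(** A cell of the face [u] is thickened by (-1, 0] in the other directions and then intersected with
    (a, b]. *)
Definition cell_lo u t (k : 'I_d -> nat) a b : d.-tuple R :=
  [tuple clamp (tnth a i) (tnth b i) (if i \in u then t i (k i) else -1) | i < d].
Definition cell_hi u t (k : 'I_d -> nat) a b : d.-tuple R :=
  [tuple clamp (tnth a i) (tnth b i) (if i \in u then t i (k i).+1 else 0) | i < d].

Lemma clamp_upd a b (z : 'I_d -> R) i r (lft : bool) :
  let r' := if lft then upd b i r else b in
  let l' := if lft then a else upd a i r in
  [tuple clamp (tnth l' j) (tnth r' j) (z j) | j < d] =
  upd [tuple clamp (tnth a j) (tnth b j) (z j) | j < d] i
    (if lft then clamp (tnth a i) r (z i) else clamp r (tnth b i) (z i)).
Proof.
apply: eq_from_tnth => j; rewrite tnth_upd !tnth_mktuple.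
by case: lft; rewrite ?tnth_upd; case: eqP => // ->.
Qed.

(** A compatible cut leaves one of the two pieces degenerate, so absolute values add up exactly. It
    can properly divide only a thickening (-1, 0], and then the piece below s carries no increment,
    as the extension vanishes there. *)
Lemma bvol_cell_cut f u n t (k : 'I_d -> nat) a b i s :
  le_pt a b -> le_pt (ptN1 R d) a ->
  (i \in u -> s <= t i (k i) \/ t i (k i).+1 <= s) ->
  (i \in u -> t i (k i) <= t i (k i).+1) ->
  let r := clamp (tnth a i) (tnth b i) s in
  `|bvol f (cell_lo u t k a b) (cell_hi u t k a b)| =
  `|bvol f (cell_lo u t k a (upd b i r)) (cell_hi u t k a (upd b i r))| +
  `|bvol f (cell_lo u t k (upd a i r) b) (cell_hi u t k (upd a i r) b)|.
Proof.
move=> ab Na cmp tk r.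
pose al j := if j \in u then t j (k j) else -1.
pose be j := if j \in u then t j (k j).+1 else 0.
have loE (p q : d.-tuple R) :
  cell_lo u t k p q = [tuple clamp (tnth p j) (tnth q j) (al j) | j < d] by [].
have hiE (p q : d.-tuple R) :
  cell_hi u t k p q = [tuple clamp (tnth p j) (tnth q j) (be j) | j < d] by [].
rewrite !loE !hiE.
have := clamp_upd a b al i r true; have := clamp_upd a b be i r true.
have := clamp_upd a b al i r false; have := clamp_upd a b be i r false.
move=> /= -> -> -> ->.
set A := [tuple clamp (tnth a j) (tnth b j) (al j) | j < d].
set B := [tuple clamp (tnth a j) (tnth b j) (be j) | j < d].
have Ai : tnth A i = clamp (tnth a i) (tnth b i) (al i) by rewrite tnth_mktuple.
have Bi : tnth B i = clamp (tnth a i) (tnth b i) (be i) by rewrite tnth_mktuple.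
have abe : al i <= be i by rewrite /al /be; case: ifP => [/tk //|_]; exact: lerN10.
have [bs|bs] := leP (be i) s.
  have [-> ->] := clamp_cutl (ab i) bs.
  have [-> ->] := clamp_cutl (ab i) (le_trans abe bs).
  rewrite -Ai -Bi !upd_id (@bvol_degen _ _ _ (upd A i _) _ i) ?normr0 ?addr0 //.
  by rewrite !tnth_upd eqxx.
have [sa|sa] := leP s (al i).
  have [-> ->] := clamp_cutr (ab i) sa.
  have [-> ->] := clamp_cutr (ab i) (le_trans sa abe).
  rewrite -Ai -Bi !upd_id (@bvol_degen _ _ _ (upd A i _) _ i) ?normr0 ?add0r //.
  by rewrite !tnth_upd eqxx.
have iu : i \notin u.
  apply/negP => iu; move: (cmp iu) sa bs; rewrite /al /be iu.
  by case; lra.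
have [-> ->] := clamp_cutl (ab i) (ltW sa).
have [-> ->] := clamp_cutr (ab i) (ltW bs).
rewrite -Ai -Bi !upd_id -/r -(bvol_cut f A B i r).
suff -> : bvol f A (upd B i r) = 0 by rewrite normr0 !add0r.
have [ai|ai] := ltP (tnth a i) 0.
  have s0 : s < 0 by move: bs; rewrite /be (negPf iu).
  apply: (@bvol_neg _ _ _ _ _ i); rewrite ?tnth_upd ?eqxx ?Ai ?/r /al ?(negPf iu)
    /clamp ?gt_max ?gt_min ?ai ?s0 ?ltrN10 ?orbT //.
apply: (@bvol_degen _ _ _ _ _ i); rewrite tnth_upd eqxx Ai /r /al (negPf iu).
have s0 : s < 0 by move: bs; rewrite /be (negPf iu).
have := ab i; rewrite /clamp !maxEle !minEle.
by repeat case: ifP => //; lra.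
Qed.

Definition cell_sum f n t N a b := \sum_(u : {set 'I_d}) \sum_(k | @cells d u n N k)
  `|bvol f (cell_lo u t (fun i => k i) a b) (cell_hi u t (fun i => k i) a b)|.

Lemma cutsum_le_cell_sum f n t N l a b :
  (forall u, grid u n t) -> (0 < N)%N -> (forall i, (n i <= N)%N) ->
  cut_compat l n t -> le_pt (ptN1 R d) a -> le_pt a b -> le_pt b (pt1 R d) ->
  cutsum (bvol f) l a b <= cell_sum f n t N a b.
Proof.
move=> gr N0 nN; elim: l a b => [|[i s] l IH] a b cmp Na ab b1 /=.
  (* The grid clamped to (a, b] ends at b, since b_i <= 1, and begins at the clamp of 0; the gap
     from a_i to there is what remains of (-1, 0]. *)
  pose t' i j := clamp (tnth a i) (tnth b i) (t i j).
  have e : bvol f a b = bvol f [tuple tnth a i | i < d] [tuple t' i (n i) | i < d].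
    congr (bvol f); apply: eq_from_tnth => i; rewrite tnth_mktuple //.
    rewrite /t'; have [_ _ -> _] := gr [set i]%SET i (finset.set11 i).
    have := b1 i; have := ab i; rewrite tnth_mktuple /clamp !maxEle !minEle.
    by repeat case: ifP => //; lra.
  rewrite {}e /bvol -(@qvol_faces_grid _ _ _ _ (tnth a) t' n N) //.
  apply: (le_trans (ler_norm_sum _ _ _)); apply: ler_sum => u _.
  apply: (le_trans (ler_norm_sum _ _ _)); apply: ler_sum => k ck.
  rewrite /bvol (_ : [tuple _ | i < d] = cell_lo u t (fun i => k i) a b); last first.
    apply: eq_from_tnth => i; rewrite !tnth_mktuple /t'; case: ifP => // _.
    have := Na i; have := ab i; rewrite tnth_mktuple /clamp !maxEle !minEle.
    by repeat case: ifP => //; lra.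
  rewrite (_ : [tuple _ | i < d] = cell_hi u t (fun i => k i) a b) //.
  apply: eq_from_tnth => i; rewrite !tnth_mktuple /t'; case: ifP => // _.
  by have [_ -> _ _] := gr [set i]%SET i (finset.set11 i).
have /andP[r1 r2] := clamp_itv s (ab i).
set r := clamp _ _ _ in r1 r2 *.
have cmpl : cut_compat l n t.
  by move=> j s' js; apply: cmp; rewrite in_cons js orbT.
have ar : le_pt a (upd b i r) by exact: le_pt_updr.
have rb : le_pt (upd a i r) b by exact: le_pt_updl.
apply: (@le_trans _ _ (cell_sum f n t N a (upd b i r) + cell_sum f n t N (upd a i r) b)).
  apply: lerD; apply: IH => //.
    by apply: le_pt_updl => //; exact: le_trans r2 (b1 i).
  by apply: le_pt_updr => //; exact: le_trans (Na i) r1.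
rewrite /cell_sum -big_split /=; apply: ler_sum => u _.
rewrite -big_split /=; apply: ler_sum => k ck.
rewrite (@bvol_cell_cut f u n t (fun i => k i) a b i s) // => iu.
  apply: (cmp i s); first exact: mem_head.
  by move/forallP: ck => /(_ i); rewrite iu.
by have [/andP[_ ->]] := grid_cell_itv (gr u) ck iu.
Qed.

(** On the whole box clamping changes nothing, so cells become those of the lower faces; the empty
    face has the single cell (-1, 0]^d, which contributes |f(0)|. *)
Lemma cell_sum_faces f n t N :
  (forall u, grid u n t) -> (0 < N)%N -> (forall i, (n i <= N)%N) ->
  cell_sum f n t N (ptN1 R d) (pt1 R d) =
  `|f (pt0 R d)| + \sum_(u : {set 'I_d} | (0 < #|u|)%N) grid_sum f u (pt0 R d) n t.
Proof.
move=> gr N0 nN.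
have clampE (z : R) : -1 <= z <= 1 -> clamp (-1) 1 z = z by exact: clamp_id.
have key u k : @cells d u n N k ->
  bvol f (cell_lo u t (fun i => k i) (ptN1 R d) (pt1 R d))
         (cell_hi u t (fun i => k i) (ptN1 R d) (pt1 R d)) =
  qvol f u (pt0 R d) [tuple t i (k i) | i < d] [tuple t i (k i).+1 | i < d].
  move=> ck; rewrite (@bvol_face _ _ f u) => [|i iu|i iu].
  - apply: eq_qvol_pts => // i iu; rewrite !tnth_mktuple iu.
    have [/andP[h1 h2] h3] := grid_cell_itv (gr u) ck iu.
    by rewrite !clampE //; apply/andP; split; lra.
  - rewrite !tnth_mktuple iu.
    have [/andP[h1 h2] h3] := grid_cell_itv (gr u) ck iu.
    by rewrite !clampE; [|apply/andP; split; lra..]; split; apply/andP; split; lra.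
  - rewrite !tnth_mktuple (negPf iu) (clampE (-1)); last by apply/andP; split; lra.
    by rewrite (clampE 0); [split; [lra|]|apply/andP; split; lra].
rewrite /cell_sum (bigD1 finset.set0) //=; congr (_ + _).
  pose k0 : {ffun 'I_d -> 'I_N} := [ffun=> Ordinal N0].
  rewrite (big_pred1 k0) => [|k].
    rewrite key ?qvol0 //; apply/forallP => i.
    by rewrite finset.in_set0 ffunE.
  apply/forallP/eqP => [h|-> i]; last by rewrite finset.in_set0 ffunE.
  apply/ffunP => i; apply: val_inj; rewrite ffunE /=.
  by have := h i; rewrite finset.in_set0 => /eqP.
apply: eq_big => [u|u u0]; first by rewrite -cards_eq0 lt0n.
rewrite (grid_sumE f (pt0 R d) _ (gr u) (fun i _ => nN i)); last first.
  by rewrite lt0n cards_eq0.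
by apply: eq_bigr => k ck; rewrite key.
Qed.

Lemma compat_grid l : exists n t, (forall u, grid u n t) /\ cut_compat l n t.
Proof.
(* The cuts within [0,1] become grid points; those outside are compatible with any grid of [0,1]. *)
pose s i := 0 :: 1 :: [seq q.2 | q <- l & (q.1 == i) && (0 <= q.2 <= 1)] : seq R.
pose p i := sort <=%R (undup (s i)).
have p_mem i z : (z \in p i) = (z \in s i) by rewrite mem_sort mem_undup.
have p_lt i : sorted <%R (p i) by rewrite sort_lt_sorted undup_uniq.
clearbody p.
have p_homo i q q' : (q <= q')%N -> (q' < size (p i))%N ->
    nth 1 (p i) q <= nth 1 (p i) q'.
  move=> qq' q's; apply: (sorted_leq_nth le_trans lexx) => //.
  - by apply: sub_sorted (p_lt i) => a b; exact: ltW.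
  - by rewrite inE (leq_ltn_trans qq').
have p01 i z : z \in p i -> 0 <= z <= 1.
  rewrite p_mem !inE => /or3P[/eqP ->|/eqP ->|]; rewrite ?lexx ?ler01 //.
  by case/mapP => c; rewrite mem_filter => /andP[/andP[_ c01] _] ->.
have p_0 i : 0 \in p i by rewrite p_mem mem_head.
have p_1 i : 1 \in p i by rewrite p_mem !inE eqxx orbT.
have sz i : (1 < size (p i))%N.
  have := p_0 i; have := p_1 i; have := @oner_neq0 R.
  by case: (p i) => [|y [|z q]] //; rewrite !inE => /eqP + /eqP h1 /eqP h0;
    rewrite h1 h0.
exists (fun i => (size (p i)).-1), (fun i k => nth 1 (p i) k).
have szE i : (size (p i)).-1.+1 = size (p i) by rewrite prednK // ltnW.
have nth_idx i z : z \in p i -> exists2 m, (m < size (p i))%N & nth 1 (p i) m = z.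
  by move=> zp; exists (index z (p i)); rewrite ?index_mem ?nth_index.
split=> [u i _|i z zl k kn]; first split.
- by rewrite -ltnS szE sz.
- have [m ms m0] := nth_idx i 0 (p_0 i).
  apply/eqP; rewrite eq_le -{1}m0 p_homo //=.
  by have /andP[] := p01 i _ (mem_nth 1 (ltnW (sz i))).
- have [m ms m1] := nth_idx i 1 (p_1 i).
  have ls : ((size (p i)).-1 < size (p i))%N by rewrite szE.
  have /andP[_ le1] := p01 i _ (mem_nth 1 ls).
  apply/eqP; rewrite eq_le le1 -[X in X <= _]m1 p_homo //.
  by rewrite -ltnS szE.
- move=> k kn; apply: (sorted_ltn_nth lt_trans) => //; rewrite inE.
  + by rewrite (leq_trans kn) // leq_pred.
  + by rewrite -ltnS szE in kn.
have ks : (k.+1 < size (p i))%N by rewrite -ltnS szE in kn.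
have [zp|zp] := boolP (z \in p i).
  have [m ms <-] := nth_idx i z zp.
  have [mk|km] := leqP m k; [left|right]; apply: p_homo => //.
  exact: ltnW.
have /andP[_ k1] := p01 i _ (mem_nth 1 ks).
have /andP[k0 _] := p01 i _ (mem_nth 1 (ltnW ks)).
have [z0|z0] := ltP z 0; first by left; exact: le_trans (ltW z0) k0.
have [z1|z1] := leP z 1; last by right; exact: le_trans k1 (ltW z1).
move: zp; rewrite p_mem !inE !negb_or => /and3P[_ _ /negP[]].
by apply/mapP; exists (i, z); rewrite // mem_filter zl /= eqxx z0 z1.
Qed.

Lemma cutsum_le_grid_sums f l : exists n t, (forall u, grid u n t) /\
  cutsum (bvol f) l (ptN1 R d) (pt1 R d) <=
  `|f (pt0 R d)| + \sum_(u : {set 'I_d} | (0 < #|u|)%N) grid_sum f u (pt0 R d) n t.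
Proof.
have [n [t [gr cmp]]] := compat_grid l; exists n, t; split=> //.
pose N := (\max_(i < d) n i).+1.
have nN i : (n i <= N)%N by apply: leqW; exact: leq_bigmax.
rewrite -(@cell_sum_faces f n t N) //; apply: cutsum_le_cell_sum => //.
by move=> i; rewrite !tnth_mktuple; lra.
Qed.

End CutsGrid.

(** * Orthants *)

Section Orthants.
Variables (R : realType) (d : nat).
Local Notation T := (d.-tuple R).
Implicit Types (x y a b c : T) (u : {set 'I_d}).

Definition orthant x : set T := [set y | le_pt y x].

Lemma measurable_orthant x : measurable (orthant x).
Proof.
apply: (@measurable_le_pt _ _ _ _ x id) => i; exact: measurable_tnth.
Qed.

Lemma measurable_nonneg : measurable [set y : T | forall i, 0 <= tnth y i].
Proof.
rewrite (_ : [set _ | _] = \bigcap_(i in [set: 'I_d]) [set y : T | 0 <= tnth y i]).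
  apply: fin_bigcap_measurable => // i _; rewrite -[X in measurable X]setTI.
  exact: (measurable_fun_ler (f := fun=> 0) (measurable_cst _) (measurable_tnth i)
    measurableT (Y := [set true])).
by apply/seteqP; split=> y h i; [move=> _|]; exact: h.
Qed.

Lemma box0E x : box0 x = orthant x `&` [set y : T | forall i, 0 <= tnth y i].
Proof.
apply/seteqP; split=> y.
  by move=> h; split=> i; have /andP[] := h i.
by case=> h1 h2 i; apply/andP; split; [exact: h2|exact: h1].
Qed.

Lemma measurable_box0 x : measurable (box0 x).
Proof.
by rewrite box0E; apply: measurableI; [exact: measurable_orthant|exact: measurable_nonneg].
Qed.

Lemma cube01E : @cube01 R d = box0 (pt1 R d).
Proof.
by apply/seteqP; split=> y h i; have := h i; rewrite tnth_mktuple.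
Qed.

Lemma measurable_cube01 : measurable (@cube01 R d).
Proof. by rewrite cube01E; exact: measurable_box0. Qed.

Lemma box0_pt0 : box0 (pt0 R d) = [set pt0 R d].
Proof.
apply/seteqP; split=> y.
  move=> h; apply: eq_from_tnth => i; apply/eqP; rewrite eq_le andbC.
  by have := h i; rewrite !tnth_mktuple.
by move=> -> i; rewrite tnth_mktuple lexx.
Qed.

(** The half-space y_i <= r is the union over n of the orthants with i-th coordinate r and all
    others n; its complements generate the product sigma-algebra. *)
Lemma orthant_gen : (@measurable _ T) = <<s range orthant >>.
Proof.
apply/seteqP; split; last first.
  apply: smallest_sub; first exact: sigma_algebra_measurable.
  by move=> _ [x _ <-]; exact: measurable_orthant.
move=> A mA.
pose T' := g_sigma_algebraType (range orthant).
suff mid : measurable_fun [set: T'] (id : T' -> T).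
  by have := mid measurableT A mA; rewrite setTI.
apply/measurable_fun_tnthP => i.
apply: (measurability _ (RGenOInfty.measurableE R)) => _ [_ [r ->] <-].
rewrite setTI.
rewrite (_ : _ @^-1` _ = ~` \bigcup_n orthant (upd [tuple n%:R | j < d] i r)).
  apply: measurableC; apply: bigcupT_measurable => n.
  by apply: sub_sigma_algebra; exists (upd [tuple n%:R | j < d] i r).
apply/seteqP; split=> y /=.
  rewrite in_itv /= andbT => ry [n _ /(_ i)].
  by rewrite tnth_upd eqxx leNgt ry.
move=> ny; rewrite in_itv /= andbT ltNge; apply/negP => yr; apply: ny.
exists (\max_j Num.bound `|tnth y j|) => //= j.
rewrite tnth_upd; case: eqP => [->//|_]; rewrite tnth_mktuple.
apply: (le_trans (ler_norm _)); apply: ltW.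
apply: (lt_le_trans (archi_boundP (normr_ge0 _))); rewrite ler_nat.
exact: (leq_bigmax (F := fun j => Num.bound `|tnth y j|)).
Qed.

Lemma orthant_setI : setI_closed (range orthant).
Proof.
move=> _ _ [x _ <-] [y _ <-].
exists [tuple Num.min (tnth x i) (tnth y i) | i < d] => //.
apply/seteqP; split=> z.
  by move=> h; split=> i; have := h i; rewrite tnth_mktuple le_min => /andP[].
by case=> h1 h2 i; rewrite tnth_mktuple le_min; apply/andP; split; [exact: h1|exact: h2].
Qed.

Lemma orthantI_cube x : orthant x `&` @cube01 R d =
  if [forall i, 0 <= tnth x i] then box0 (clip x) else set0.
Proof.
case: forallP => [x0|nx]; apply/seteqP; split=> y //.
- move=> [yx y01] i; rewrite tnth_mktuple le_min yx andbA andbT.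
  exact: y01.
- move=> h; split=> i; have := h i; rewrite tnth_mktuple le_min => /and3P[h1 h2 h3] //.
  by rewrite h1.
- move=> [yx y01]; apply: nx => i; apply: le_trans (yx i).
  by have /andP[] := y01 i.
Qed.

(** Orthants form a generating pi-system, and an orthant meets the cube in the empty set or in some
    [box0 (clip x)]. *)
Lemma charge_box0_unique (nu nu' : {charge set T -> \bar R}) :
  on_cube nu -> on_cube nu' ->
  (forall x, in01 x -> nu (box0 x) = nu' (box0 x)) ->
  forall A, measurable A -> nu A = nu' A.
Proof.
move=> on on' eqb A mA.
have clip01 x : [forall i, 0 <= tnth x i] -> in01 (clip x).
  move=> /forallP x0 i.
  by rewrite tnth_mktuple le_min x0 ler01 ge_min lexx orbT.
apply: (@dynkin_induction _ T (range orthant) (fun A => nu A = nu' A) orthant_gen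
  orthant_setI) => //.
- rewrite on // on' // setTI cube01E; apply: eqb.
  exact: pt1_in01.
- move=> _ [x _ <-].
  rewrite (on _ (measurable_orthant x)) (on' _ (measurable_orthant x)) orthantI_cube; case: ifP => [/clip01/eqb //|_].
  by rewrite !charge0.
- move=> S mS nS; rewrite -setTD !chargeD // !setTI nS; congr (_ - _)%E.
  rewrite on // on' // setTI cube01E; apply: eqb.
  exact: pt1_in01.
- move=> F mF tF nF.
  have h1 := @charge_semi_sigma_additive _ _ _ nu F mF tF (bigcupT_measurable F mF).
  have h2 := @charge_semi_sigma_additive _ _ _ nu' F mF tF (bigcupT_measurable F mF).
  have e : (fun n => \sum_(0 <= i < n) nu (F i))%E = (fun n => \sum_(0 <= i < n) nu' (F i))%E.
    by apply/funext => n; apply: eq_bigr => k _; exact: nF.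
  by rewrite e in h1; exact: (cvg_unique _ h1 h2).
- by rewrite -orthant_gen.
Qed.

End Orthants.

(** * Distribution functions *)

Section DistributionFunction.
Variables (R : realType) (d : nat).
Local Notation T := (d.-tuple R).
Implicit Types (x y a b c : T) (u : {set 'I_d}).
Variable m : {measure set T -> \bar R}.
Hypothesis mfin : (m setT < +oo)%E.

Definition box_cdf (mu : set T -> \bar R) x : R := fine (mu (box0 x)).

Lemma finite_measure_fin_num A : measurable A -> m A \is a fin_num.
Proof.
move=> mA; rewrite ge0_fin_numE ?measure_ge0 //; apply: le_lt_trans mfin.
by apply: le_measure; rewrite ?inE.
Qed.

Lemma box_cdfE x : m (box0 x) = (box_cdf m x)%:E.
Proof. by rewrite fineK // finite_measure_fin_num //; exact: measurable_box0. Qed.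

(** The set whose mass is the quasi-volume of the distribution function: half-open sides in the
    differenced directions, and [0, c_i] in the others, where nothing is subtracted. *)
Definition region u c a b : set T := [set y | forall i,
  if i \in u then tnth a i < tnth y i <= tnth b i else 0 <= tnth y i <= tnth c i].

Lemma measurable_region u c a b : measurable (region u c a b).
Proof.
rewrite (_ : region _ _ _ _ = \bigcap_(i in [set: 'I_d]) [set y : T |
    if i \in u then tnth a i < tnth y i <= tnth b i else 0 <= tnth y i <= tnth c i]).
  apply: fin_bigcap_measurable => // i _; have mi := @measurable_tnth _ R d i.
  case: (i \in u).
    rewrite (_ : [set _ | _] = (fun y : T => tnth y i) @^-1` `]tnth a i, tnth b i]).
      by rewrite -[X in measurable X]setTI; exact: mi.
    by apply/seteqP; split=> y /=; rewrite in_itv.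
  rewrite (_ : [set _ | _] = (fun y : T => tnth y i) @^-1` `[0, tnth c i]).
    by rewrite -[X in measurable X]setTI; exact: mi.
  by apply/seteqP; split=> y /=; rewrite in_itv.
by apply/seteqP; split=> y h i; [move=> _|]; exact: h.
Qed.

Lemma qvol_box_cdf u c a b : (forall i, i \in u -> 0 <= tnth a i <= tnth b i) ->
  qvol (box_cdf m) u c a b = fine (m (region u c a b)).
Proof.
move: {2}#|u| (erefl #|u|) => k; elim: k u c => [|k IH] u c uk ab.
  move/eqP: uk; rewrite cards_eq0 => /eqP ->; rewrite qvol0 /box_cdf; congr (fine (m _)).
  by apply/seteqP; split=> y h i; have := h i; rewrite finset.in_set0.
have /card_gt0P[i iu] : (0 < #|u|)%N by rewrite uk.
pose v := (u :\ i)%SET.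
have iv : i \notin v by rewrite !inE eqxx.
have uv : (i |: v)%SET = u by rewrite finset.setD1K.
have vk : #|v| = k by have := cardsU1 i v; rewrite uv uk iv => -[].
have abv j : j \in v -> 0 <= tnth a j <= tnth b j.
  by rewrite !inE => /andP[_]; exact: ab.
have := qvol_setU1 (box_cdf m) c a b iv; rewrite uv !(IH v) //.
have /andP[a0 aib] := ab i iu.
have jv j : j != i -> (j \in v) = (j \in u) by rewrite !inE => ->.
have -> : region v (upd c i (tnth b i)) a b =
    region u c a b `|` region v (upd c i (tnth a i)) a b.
  apply/seteqP; split=> y.
    move=> h; have := h i; rewrite (negPf iv) tnth_upd eqxx => /andP[y0 yb].
    have [ay|ya] := ltP (tnth a i) (tnth y i); [left|right] => j; have := h j;
      rewrite !tnth_upd; have [->|ji] := eqVneq j i.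
    - by rewrite iu ay yb.
    - by rewrite jv.
    - by rewrite (negPf iv) y0 ya.
    - by [].
  case=> h j; have := h j; rewrite !tnth_upd; have [->|ji] := eqVneq j i.
  - by rewrite iu (negPf iv) => /andP[ay ->]; rewrite andbT; apply: le_trans a0 (ltW ay).
  - by rewrite jv.
  - by rewrite (negPf iv) => /andP[-> ya]; exact: le_trans ya aib.
  - by [].
rewrite measureU; [|exact: measurable_region..|]; last first.
  apply/seteqP; split=> // y [/(_ i) + /(_ i)].
  rewrite iu (negPf iv) tnth_upd eqxx => /andP[ay _] /andP[_].
  by rewrite leNgt ay.
rewrite fineD; try by apply: finite_measure_fin_num; exact: measurable_region.
by move=> /addIr.
Qed.

Lemma box_cdf_cm : completely_monotone (box_cdf m).
Proof.
move=> u c a b u0 c01 ab; rewrite qvol_box_cdf; last by move=> i _; case: (ab i).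
exact: fine_ge0.
Qed.

Lemma le_box_cdf x y : le_pt x y -> box_cdf m x <= box_cdf m y.
Proof.
move=> xy; rewrite -lee_fin -!box_cdfE; apply: le_measure; rewrite ?inE;
  try exact: measurable_box0.
by move=> z zx i; have /andP[-> zi] := zx i; exact: le_trans zi (xy i).
Qed.

(** Continuity from above along the steps 1/(n+1); monotonicity extends the limit to all s
    decreasing to x_i. *)
Lemma box_cdf_rc : right_continuous01 (box_cdf m).
Proof.
move=> x i x01 x1; apply/cvgrPdist_le => e e0.
pose F n := box0 (upd x i (tnth x i + n.+1%:R^-1)).
have le_upd s s' : s <= s' -> le_pt (upd x i s) (upd x i s').
  by move=> ss' j; rewrite !tnth_upd; case: eqP.
have FE : \bigcap_n F n = box0 x.
  apply/seteqP; split=> y.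
    move=> h j; have := h 0%N I j; rewrite tnth_upd; case: eqP => // ji /andP[y0 _].
    rewrite y0 /=; subst j; apply/ler_addgt0Pr => e' e'0.
    have /andP[_] := h (Num.bound e'^-1) I i; rewrite tnth_upd eqxx => /le_trans; apply.
    rewrite lerD2l invf_ple ?posrE //.
    have h1 : e'^-1 < (Num.bound e'^-1)%:R by apply: archi_boundP; rewrite invr_ge0 ltW.
    by apply: ltW (lt_le_trans h1 _); rewrite ler_nat.
  move=> h n _ j; have /andP[-> yx] := h j; rewrite tnth_upd; case: eqP => // ji.
  by subst j; apply: le_trans yx _; rewrite lerDl invr_ge0.
have mF n : measurable (F n) by exact: measurable_box0.
have cv : (m \o F) n @[n --> \oo] --> m (\bigcap_n F n).
  apply: nonincreasing_cvg_mu => //.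
  - by rewrite -ge0_fin_numE ?measure_ge0 // finite_measure_fin_num.
  - by rewrite FE; exact: measurable_box0.
  move=> p q pq; apply/subsetPset => y h j; have /andP[-> hy] := h j.
  apply: le_trans hy _; apply: le_upd; rewrite lerD2l lef_pV2 ?posrE //.
  by rewrite ler_nat ltnS.
have {}cv : box_cdf m (upd x i (tnth x i + n.+1%:R^-1)) @[n --> \oo] --> box_cdf m x.
  by apply: fine_cvg; rewrite -box_cdfE -FE; exact: cv.
have [n _ /(_ n (leqnn n))] := (cvgrPdist_le _ _).1 cv e e0.
set s0 := tnth x i + _ => hn.
have le_x s : tnth x i <= s -> box_cdf m x <= box_cdf m (upd x i s).
  by move=> xs; apply: le_box_cdf => j; rewrite tnth_upd; case: eqP => // ->.
have s0x : tnth x i < s0 by rewrite ltrDl invr_gt0.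
rewrite near_withinE; exists (n.+1%:R^-1); first by rewrite /= invr_gt0.
move=> s hs xs; have ss0 : s <= s0.
  move: hs; rewrite /= distrC gtr0_norm ?subr_gt0 // ltrBlDr addrC => /ltW.
  by [].
have h1 := le_x s (ltW xs); have h2 := le_box_cdf (le_upd _ _ ss0).
rewrite distrC ger0_norm ?subr_ge0 //.
have h3 := le_x s0 (ltW s0x); move: hn; rewrite distrC ger0_norm ?subr_ge0 //.
by apply: le_trans; rewrite lerD2r.
Qed.

End DistributionFunction.

(** * Hardy-Krause variation *)

Section HardyKrause.
Variables (R : realType) (d : nat).
Local Notation T := (d.-tuple R).
Implicit Types (f g w : T -> R) (x y a b c : T) (u : {set 'I_d}).
Local Notation pt0 := (pt0 R d).
Local Notation pt1 := (pt1 R d).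
Local Notation ptN1 := (ptN1 R d).
Local Notation cube01 := (@cube01 R d).

Lemma sum_nonempty_qvol g x :
  \sum_(u : {set 'I_d} | (0 < #|u|)%N) qvol g u pt0 pt0 x = g x - g pt0.
Proof.
rewrite -[in RHS](sum_qvol g pt0 x) [X in _ = X - _](bigD1 finset.set0) //=.
rewrite qvol0 addrAC subrr add0r.
by apply: eq_bigl => u; rewrite lt0n cards_eq0.
Qed.

Lemma VarHK0_cm g : completely_monotone g -> VarHK0 g = (g pt1 - g pt0)%:E.
Proof.
move=> cm; rewrite -sum_nonempty_qvol -sumEFin; apply: eq_bigr => u u0.
by rewrite vitali_var_cm //; exact: pt0_in01.
Qed.

Definition dominated f g := forall u c a b, (0 < #|u|)%N -> in01 c ->
  (forall i, i \in u -> 0 <= tnth a i <= tnth b i /\ tnth b i <= 1) ->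
  `|qvol f u c a b| <= qvol g u c a b.

Lemma vitali_var_dominated f g u c : dominated f g -> (0 < #|u|)%N -> in01 c ->
  (vitali_var f u c <= (qvol g u c pt0 pt1)%:E)%E.
Proof.
move=> fg u0 c01; apply: vitali_var_le => n t gr; rewrite lee_fin.
by apply: grid_sum_le => // a b ab; exact: fg.
Qed.

Lemma bounded_HK_dominated f g : dominated f g -> bounded_HK f.
Proof.
move=> fg; apply: (@le_lt_trans _ _
  (\sum_(u : {set 'I_d} | (0 < #|u|)%N) qvol g u pt1 pt0 pt1)%:E); last exact: ltry.
rewrite -sumEFin; apply: lee_sum => u u0.
by apply: vitali_var_dominated => //; exact: pt1_in01.
Qed.

Lemma VarHK0_dominated f g : dominated f g -> (VarHK0 f <= (g pt1 - g pt0)%:E)%E.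
Proof.
move=> fg; rewrite -sum_nonempty_qvol -sumEFin; apply: lee_sum => u u0.
by apply: vitali_var_dominated => //; exact: pt0_in01.
Qed.

Lemma VarHK0_lty f : bounded_HK f -> (VarHK0 f < +oo)%E.
Proof.
move=> bf; apply: lte_sum_pinfty => u u0; apply: vitali_var_anchor0 => // v v0.
apply: le_lt_trans bf; rewrite /VarHK (bigD1 v) //= leeDl //.
by apply: sume_ge0 => ? _; exact: vitali_var_ge0.
Qed.

Lemma VarHK0_ge0 f : (0 <= VarHK0 f)%E.
Proof. by apply: sume_ge0 => u _; exact: vitali_var_ge0. Qed.

Lemma cutsum_le_VarHK0 f l : (VarHK0 f < +oo)%E ->
  cutsum (bvol f) l ptN1 pt1 <= fine (VarHK0 f) + `|f pt0|.
Proof.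
move=> bf; have [n [t [gr]]] := cutsum_le_grid_sums f l.
move=> /le_trans; apply; rewrite addrC lerD2r -lee_fin fineK; last first.
  by rewrite ge0_fin_numE ?VarHK0_ge0.
rewrite -sumEFin; apply: lee_sum => u _; exact: grid_sum_le_vitali.
Qed.

Lemma eq_cm f g : (forall x, in01 x -> f x = g x) ->
  completely_monotone f -> completely_monotone g.
Proof.
move=> fg cm u c a b u0 c01 ab; rewrite -(@eq_qvol _ _ f) ?cm // => J _ /=.
apply: fg => i; rewrite tnth_vertex; have [/andP[a0 aib] b1] := ab i.
case: ifP => _; first by rewrite a0 (le_trans aib).
by case: ifP => _; [rewrite b1 (le_trans a0)|exact: c01].
Qed.

Lemma cmD f g : completely_monotone f -> completely_monotone g ->
  completely_monotone (fun x => f x + g x).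
Proof. by move=> cf cg u c a b *; rewrite qvolD addr_ge0 ?cf ?cg. Qed.

Lemma cm_cst (k : R) : completely_monotone (fun _ : T => k).
Proof. by move=> u c a b u0 *; rewrite qvol_cst. Qed.

Lemma le_ptN1_pt1 : le_pt ptN1 pt1.
Proof. by move=> i; rewrite !tnth_mktuple; lra. Qed.

Lemma in01_le_pt x : in01 x -> le_pt ptN1 x /\ le_pt x pt1.
Proof.
by move=> x01; split=> i; have /andP[x0 x1] := x01 i; rewrite tnth_mktuple; lra.
Qed.

(* Any w dominating the increments of f has mass at least the variation of f on
   every box; if the total masses agree, additivity forces equality. *)
Lemma box_variation_eq f w : (VarHK0 f < +oo)%E ->
  completely_monotone (fun x => w x + f x) ->
  completely_monotone (fun x => w x - f x) ->
  `|f pt0| <= w pt0 -> w pt1 <= box_variation (bvol f) ptN1 pt1 ->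
  forall x, in01 x -> w x = box_variation (bvol f) ptN1 x.
Proof.
move=> bf cp cm w0 w1 x x01; have [Nx x1] := in01_le_pt x01.
have bnd l := cutsum_le_VarHK0 l bf.
have domv a b : le_pt a b -> `|bvol f a b| <= bvol w a b.
  move=> ab; have := bvol_ge0 cp _ ab; have := bvol_ge0 cm _ ab.
  rewrite !bvolD bvolN; move: w0; rewrite !ler_norml => /andP[h1 h2].
  by rewrite subr_ge0 => /(_ h2) k1 /(_ _)k2; have := k2 ltac:(lra); lra.
have cutw l a b : le_pt a b -> cutsum (bvol f) l a b <= bvol w a b.
  elim: l a b => [|[i s] l IH] a b ab /=; first exact: domv.
  have /andP[r1 r2] := clamp_itv s (ab i).
  rewrite -(bvol_cut w a b i (clamp (tnth a i) (tnth b i) s)).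
  by apply: lerD; apply: IH; [exact: le_pt_updr|exact: le_pt_updl].
pose D a b := bvol w a b - box_variation (bvol f) a b.
have Dadd a b i r : le_pt ptN1 a -> le_pt a b -> le_pt b pt1 ->
    tnth a i <= r <= tnth b i -> D a (upd b i r) + D (upd a i r) b = D a b.
  move=> h1 h2 h3 h4; rewrite /D -(bvol_cut w a b i r).
  by rewrite -(box_variation_add (bvol_cut f) bnd h1 h2 h3 h4); lra.
have D0 a b : le_pt ptN1 a -> le_pt a b -> le_pt b pt1 -> 0 <= D a b.
  by move=> _ h2 _; rewrite subr_ge0; apply: box_variation_le => l; exact: cutw.
have := box_fun_mono Dadd D0 (@le_pt_refl _ _ ptN1) (@le_pt_refl _ _ ptN1) Nx x1
  (@le_pt_refl _ _ pt1).
have := D0 ptN1 x (@le_pt_refl _ _ ptN1) Nx x1.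
rewrite /D !bvol_N1 !ext_in01 //; last exact: pt1_in01.
lra.
Qed.

Lemma cutsum_neg f l a b i : tnth a i < 0 -> tnth b i < 0 -> cutsum (bvol f) l a b = 0.
Proof.
elim: l a b => [|[j s] l IH] a b ai bi /=.
  by rewrite (bvol_neg _ ai bi) normr0.
have [ij|ij] := eqVneq i j.
  subst j; have r0 : clamp (tnth a i) (tnth b i) s < 0.
    by rewrite /clamp gt_max ai gt_min bi.
  by rewrite !IH ?addr0 // tnth_upd eqxx.
by rewrite !IH ?addr0 // tnth_upd (negPf ij).
Qed.

Lemma box_variation_neg f x i : tnth x i < 0 -> box_variation (bvol f) ptN1 x = 0.
Proof.
move=> xi; have h l : cutsum (bvol f) l ptN1 x = 0.
  by apply: (@cutsum_neg f l ptN1 x i) => //; rewrite tnth_mktuple ltrN10.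
rewrite /box_variation; suff -> : range (fun l => cutsum (bvol f) l ptN1 x) = [set 0] by rewrite sup1.
apply/seteqP; split=> z; first by case=> l _ <-; rewrite h.
by move=> ->; exists [::].
Qed.

(** A point outside the cube either leaves the orthant of [pt1], a null set, or has a coordinate at
    most -1/(n+1) for some n; the latter points lie in countably many null orthants. *)
Lemma on_cube_orthant (m : {measure set T -> \bar R}) : (m setT < +oo)%E ->
  m (orthant pt1) = m setT ->
  (forall x i, le_pt ptN1 x -> le_pt x pt1 -> tnth x i < 0 -> m (orthant x) = 0%E) ->
  on_cube m.
Proof.
move=> mTy m1 m0; have mC := measurableC (@measurable_cube01 R d).
suff C0 : m (~` cube01) = 0%E.
  move=> A mA; rewrite -[in LHS](setIT A) -(setUCr cube01) setIUr.
  rewrite measureU; [|by apply: measurableI => //; exact: measurable_cube01|exact: measurableI|].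
    rewrite [X in (_ + X)%E](_ : _ = 0%E) ?adde0 //.
    apply: (subset_measure0 _ _ (@subIsetr _ A _) C0) => //; exact: measurableI.
  by rewrite setIACA setICr setI0.
have o1 : m (~` orthant pt1) = 0%E.
  have mo := @measurable_orthant R d pt1.
  have mT : m setT \is a fin_num by exact: finite_measure_fin_num.
  have e := measureD measurableT mo mTy; rewrite setTI in e.
  have h : (m setT - m (orthant pt1) = 0)%E by rewrite m1 subee.
  by rewrite -setTD; exact: etrans e h.
pose F (p : 'I_d) n := orthant (upd pt1 p (- n.+1%:R^-1)).
have F0 p n : m (F p n) = 0%E.
  have n1 : n.+1%:R^-1 <= 1 :> R by rewrite invf_le1 ?ler1n.
  have n0 : 0 < n.+1%:R^-1 :> R by rewrite invr_gt0.
  rewrite /F; move: n1 n0; move: (n.+1%:R^-1) => q q1 q0.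
  apply: (m0 _ p); last by rewrite tnth_upd eqxx oppr_lt0.
    by move=> j; rewrite tnth_upd !tnth_mktuple; case: eqP => _; lra.
  by move=> j; rewrite tnth_upd !tnth_mktuple; case: eqP => _; lra.
pose G q := if insub q is Some p then \bigcup_n F p n else set0.
have nG : m.-negligible (\bigcup_q G q).
  apply: negligible_bigcup => q; rewrite /G; case: insubP => [p _ _|_].
    apply: negligible_bigcup => n; apply/negligibleP; last exact: F0.
    exact: measurable_orthant.
  exact: negligible_set0.
have no1 : m.-negligible (~` orthant pt1).
  apply/negligibleP; last exact: o1.
  by apply: measurableC; exact: measurable_orthant.
apply/negligibleP; first exact: mC.
apply: negligibleS (negligibleU no1 nG).
move=> y ny; have [y1|] := pselect (orthant pt1 y); last by left.
right; have [p yp] : exists p, tnth y p < 0.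
  apply: contrapT => h; apply: ny => i; have := y1 i; rewrite tnth_mktuple => ->.
  by rewrite andbT leNgt; apply/negP => yi; apply: h; exists i.
exists p => //; rewrite /G valK.
exists (Num.bound (- tnth y p)^-1) => // j.
rewrite tnth_upd; case: eqP => [->|_]; last exact: y1.
rewrite lerNr invf_ple ?posrE ?oppr_gt0 //.
have h1 : (- tnth y p)^-1 < (Num.bound (- tnth y p)^-1)%:R.
  by apply: archi_boundP; rewrite invr_ge0 oppr_ge0 ltW.
by apply: ltW (lt_le_trans h1 _); rewrite ler_nat.
Qed.

End HardyKrause.

(** * Charges and functions *)

Section Representation.
Variables (R : realType) (d : nat).
Local Notation T := (d.-tuple R).
Implicit Types (f g w : T -> R) (x y a b c : T) (u : {set 'I_d}).
Local Notation pt0 := (pt0 R d).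
Local Notation pt1 := (pt1 R d).
Local Notation ptN1 := (ptN1 R d).
Local Notation cube01 := (@cube01 R d).

Lemma box0_on_cube (m : {measure set T -> \bar R}) x :
  on_cube m -> in01 x -> m (box0 x) = m (orthant x).
Proof.
move=> on x01; rewrite (on _ (measurable_orthant x)) orthantI_cube.
rewrite (introT forallP) => [|i]; first by rewrite clip_in01.
by case/andP: (x01 i).
Qed.

Lemma charge_exists f : right_continuous01 f -> bounded_HK f ->
  exists m1 m2 : {finite_measure set T -> \bar R},
    exists nu : {charge set T -> \bar R},
    [/\ on_cube nu, represents nu f,
        forall A, nu A = (m1 A - m2 A)%E &
        (m1 setT + m2 setT = (box_variation (bvol f) ptN1 pt1)%:E)%E].
Proof.
move=> rc /VarHK0_lty bf.
have [m1 [m2 [m1E m2E m1T m2T]]] := signed_box_measures (bvol_cut f) (@le_ptN1_pt1 R d)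
  (fun l => cutsum_le_VarHK0 l bf) (fun a b i e => @bvol_rc _ _ f a b i e rc).
have N1 : le_pt ptN1 pt1 by exact: le_ptN1_pt1.
have m1o x : le_pt ptN1 x -> le_pt x pt1 ->
    m1 (orthant x) = ((box_variation (bvol f) ptN1 x + bvol f ptN1 x) / 2)%:E.
  by move=> ? ?; exact: m1E.
have m2o x : le_pt ptN1 x -> le_pt x pt1 ->
    m2 (orthant x) = ((box_variation (bvol f) ptN1 x - bvol f ptN1 x) / 2)%:E.
  by move=> ? ?; exact: m2E.
have v0 x i : tnth x i < 0 ->
    box_variation (bvol f) ptN1 x = 0 /\ bvol f ptN1 x = 0.
  by move=> xi; rewrite (box_variation_neg _ xi) bvol_N1 (ext_neg _ xi).
have fin_lty (m : {finite_measure set T -> \bar R}) : (m setT < +oo)%E.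
  by rewrite -ge0_fin_numE ?measure_ge0 // fin_num_measure.
have on1 : on_cube m1.
  have e : m1 (orthant pt1) = m1 setT by rewrite m1T m1o //; exact: le_pt_refl.
  have z x i : le_pt ptN1 x -> le_pt x pt1 -> tnth x i < 0 -> m1 (orthant x) = 0%E.
    by move=> Nx x1 /v0[e1 e2]; rewrite m1o // e1 e2 addr0 mul0r.
  exact: on_cube_orthant (fin_lty m1) e z.
have on2 : on_cube m2.
  have e : m2 (orthant pt1) = m2 setT by rewrite m2T m2o //; exact: le_pt_refl.
  have z x i : le_pt ptN1 x -> le_pt x pt1 -> tnth x i < 0 -> m2 (orthant x) = 0%E.
    by move=> Nx x1 /v0[e1 e2]; rewrite m2o // e1 e2 subr0 mul0r.
  exact: on_cube_orthant (fin_lty m2) e z.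
pose nu : {charge set T -> \bar R} :=
  cadd (charge_of_finite_measure m1) (copp (charge_of_finite_measure m2)).
have nuE A : nu A = (m1 A - m2 A)%E by [].
exists m1, m2, nu; split=> //.
- by move=> A mA; rewrite !nuE (on1 A mA) (on2 A mA).
- move=> x x01; have [Nx x1] := in01_le_pt x01.
  have -> : nu (box0 x) = (m1 (orthant x) - m2 (orthant x))%E.
    by rewrite nuE; congr (_ - _)%E; exact: box0_on_cube.
  rewrite m1o // m2o // -EFinB; congr EFin.
  by rewrite bvol_N1 ext_in01 //; lra.
- by rewrite m1T m2T -EFinD; congr EFin; lra.
Qed.

(** All of [np] lives on P, where [nm] vanishes, so np(P) = nu(P) = m1(P) - m2(P) <= m1(P);
    symmetrically on the complement. *)
Lemma jordan_charge_min (nu : {charge set T -> \bar R})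
    (np nm : {measure set T -> \bar R}) (m1 m2 : {finite_measure set T -> \bar R}) :
  jordan_charge nu np nm ->
  (forall A, measurable A -> nu A = (m1 A - m2 A)%E) ->
  (np setT <= m1 setT)%E /\ (nm setT <= m2 setT)%E.
Proof.
move=> [[P [mP npP nmP]] nuE] nuE12.
have mC := measurableC mP.
have split_le (m m' : {measure set T -> \bar R}) A : measurable A ->
    m (~` A) = 0%E -> (m A <= m' A)%E -> (m setT <= m' setT)%E.
  move=> mA mC0 le; have e : (m setT = m A + m (~` A))%E.
    by rewrite -(setUCr A) measureU ?setICr //; exact: measurableC.
  rewrite e mC0 adde0; apply: (le_trans le); apply: le_measure; rewrite ?inE //.
split.
  apply: (split_le _ _ P) => //.
  have := nuE P mP; rewrite nmP sube0 nuE12 // => <-.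
  by rewrite leeBlDr ?fin_num_measure // leeDl.
apply: (split_le _ _ (~` P)) => //; first by rewrite setCK.
have := nuE _ mC; rewrite npP sub0e nuE12 // => /(congr1 oppe).
rewrite oppeK oppeB ?fin_num_adde_defr ?fin_num_measure // => <-.
by rewrite addeC leeBlDr ?fin_num_measure // leeDl.
Qed.

End Representation.

Section Correspondence.
Variables (R : realType) (d : nat).
Local Notation T := (d.-tuple R).
Implicit Types (f g w : T -> R) (x y a b c : T) (u : {set 'I_d}).
Local Notation pt0 := (pt0 R d).
Local Notation pt1 := (pt1 R d).
Local Notation ptN1 := (ptN1 R d).
Local Notation cube01 := (@cube01 R d).

Lemma finite_measure_lty (m : {finite_measure set T -> \bar R}) : (m setT < +oo)%E.
Proof. by rewrite -ge0_fin_numE ?measure_ge0 // fin_num_measure. Qed.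

Lemma charge_parts (nu : {charge set T -> \bar R}) :
  exists m1 m2 : {finite_measure set T -> \bar R},
    forall A, measurable A -> nu A = (m1 A - m2 A)%E.
Proof.
have [P [N nuPN]] := Hahn_decomposition nu.
exists (jordan_pos nuPN), (jordan_neg nuPN) => A mA.
by rewrite (jordan_decomp nuPN mA) /cadd /= cscaleN1.
Qed.

Section Decomposition.
Variables (nu : {charge set T -> \bar R}) (f : T -> R).
Variables (mp mm : {measure set T -> \bar R}).
Hypotheses (mpT : (mp setT < +oo)%E) (mmT : (mm setT < +oo)%E).
Hypothesis nuE : forall A, measurable A -> nu A = (mp A - mm A)%E.
Hypothesis nu_f : represents nu f.

Lemma represents_box_cdf x : in01 x -> f x = box_cdf mp x - box_cdf mm x.
Proof.
move=> x01; apply: EFin_inj; rewrite -nu_f // nuE; last exact: measurable_box0.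
by rewrite EFinB -(box_cdfE mpT) -(box_cdfE mmT).
Qed.

Lemma represents_rc : right_continuous01 f.
Proof.
move=> x i x01 x1; rewrite (represents_box_cdf x01).
have cv := cvgB (box_cdf_rc mpT x01 x1) (box_cdf_rc mmT x01 x1).
have e : \forall s \near (tnth x i)^'+,
    box_cdf mp (upd x i s) - box_cdf mm (upd x i s) = f (upd x i s).
  rewrite near_withinE; exists (1 - tnth x i); first by rewrite /= subr_gt0.
  move=> s hs xs /=; rewrite represents_box_cdf // => j; rewrite tnth_upd.
  case: eqP => // ji; have /andP[x0 _] := x01 i.
  rewrite (le_trans x0 (ltW xs)) /=.
  by move: hs; rewrite /= distrC gtr0_norm ?subr_gt0 // ltrD2r => /ltW.
exact: (cvg_trans (near_eq_cvg e) (cv _)).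
Qed.

Lemma represents_dominated : dominated f (fun x => box_cdf mp x + box_cdf mm x).
Proof.
move=> u c a b u0 c01 ab.
have -> : qvol f u c a b = qvol (box_cdf mp) u c a b - qvol (box_cdf mm) u c a b.
  rewrite -qvolN -qvolD; apply: eq_qvol => J /fintype.subsetP Ju /=.
  apply: represents_box_cdf => i; rewrite tnth_vertex.
  case: ifP => [/Ju/ab[/andP[a0 aib] b1]|_]; first by rewrite a0 (le_trans aib).
  case: ifP => [/ab[/andP[a0 aib] ->]|_]; last exact: c01.
  by rewrite (le_trans a0).
have h1 := cm_qvol_ge0 (box_cdf_cm mpT) u0 c01 ab.
have h2 := cm_qvol_ge0 (box_cdf_cm mmT) u0 c01 ab.
by rewrite qvolD ler_norml; apply/andP; split; lra.
Qed.

Lemma cm_plus : completely_monotone (fun x => box_cdf mp x + box_cdf mm x + f x).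
Proof.
apply: (@eq_cm _ _ (fun x => box_cdf mp x + box_cdf mp x)) => [x x01|].
  by rewrite represents_box_cdf //; lra.
by apply: cmD; exact: box_cdf_cm.
Qed.

(** On the cube this function is twice the distribution function of [mm]. *)
Lemma cm_minus : completely_monotone (fun x => box_cdf mp x + box_cdf mm x - f x).
Proof.
apply: (@eq_cm _ _ (fun x => box_cdf mm x + box_cdf mm x)) => [x x01|].
  by rewrite represents_box_cdf //; lra.
by apply: cmD; exact: box_cdf_cm.
Qed.

Lemma box_cdf_pt0 : `|f pt0| <= box_cdf mp pt0 + box_cdf mm pt0.
Proof.
have h1 : 0 <= box_cdf mp pt0 by exact: fine_ge0.
have h2 : 0 <= box_cdf mm pt0 by exact: fine_ge0.
by rewrite represents_box_cdf; [rewrite ler_norml; apply/andP; split; lra|exact: pt0_in01].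
Qed.

End Decomposition.

(** Domination of f by the sum g of the two distribution functions gives Var_HK0 f <= g(1) - g(0)
    with |f(0)| <= g(0); minimality of [np], [nm] against the charge built from f gives g(1) <= V;
    grids give V <= Var_HK0 f + |f(0)|. *)
Lemma represents_total (nu : {charge set T -> \bar R}) f
    (np nm : {measure set T -> \bar R}) :
  on_cube nu -> represents nu f -> jordan_charge nu np nm ->
  [/\ (np setT < +oo)%E, (nm setT < +oo)%E,
      right_continuous01 f /\ bounded_HK f,
      VarHK0 f = (box_variation (bvol f) ptN1 pt1 - `|f pt0|)%:E &
      box_cdf np pt1 + box_cdf nm pt1 = box_variation (bvol f) ptN1 pt1].
Proof.
move=> on nu_f jnu; have nuE := jnu.2.
(* A Hahn decomposition supplies finite parts, and minimality then makes [np] and [nm] finite. *)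
have [m1 [m2 nu12]] := charge_parts nu.
have [np1 nm2] := jordan_charge_min jnu nu12.
have npT := le_lt_trans np1 (finite_measure_lty m1).
have nmT := le_lt_trans nm2 (finite_measure_lty m2).
have rc := represents_rc npT nmT nuE nu_f.
have dom := represents_dominated npT nmT nuE nu_f.
have bf := bounded_HK_dominated dom.
have Vf := VarHK0_lty bf.
have [q1 [q2 [nu' [on' nu'_f nu'E qT]]]] := charge_exists rc bf.
have eqnu A : measurable A -> nu A = (q1 A - q2 A)%E.
  move=> mA; rewrite -nu'E; apply: charge_box0_unique => // x x01.
  by rewrite nu_f // nu'_f.
have [npq nmq] := jordan_charge_min jnu eqnu.
set V := box_variation _ _ _ in qT *.
have gV : box_cdf np pt1 + box_cdf nm pt1 <= V.
  rewrite -lee_fin EFinD -(box_cdfE npT) -(box_cdfE nmT) -qT; apply: leeD.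
    apply: le_trans npq; apply: le_measure; rewrite ?inE //; exact: measurable_box0.
  apply: le_trans nmq; apply: le_measure; rewrite ?inE //; exact: measurable_box0.
have VE : VarHK0 f = (fine (VarHK0 f))%:E.
  by rewrite fineK // ge0_fin_numE ?VarHK0_ge0.
have VV : V <= fine (VarHK0 f) + `|f pt0|.
  by apply: box_variation_le => l; exact: cutsum_le_VarHK0.
have := VarHK0_dominated dom; rewrite VE lee_fin => Vg.
have f0 := box_cdf_pt0 npT nmT nuE nu_f.
split=> //; last lra.
by congr EFin; lra.
Qed.

Lemma represents_var_identity (nu : {charge set T -> \bar R}) f :
  on_cube nu -> represents nu f -> var_identity nu f.
Proof.
move=> on nu_f np nm jnu.
have [npT nmT _ -> g1] := represents_total on nu_f jnu.
rewrite cube01E (box_cdfE npT) (box_cdfE nmT) -!EFinD; congr EFin.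
by rewrite g1; lra.
Qed.

(** [box_variation_eq] with w = fp + fm + |f(0)|: up to constants w + f and w - f are 2 fp and 2 fm,
    and additivity of the variations in [jordan_fun] fixes w(1). *)
Lemma jordan_fun_sum f fp fm : bounded_HK f ->
  VarHK0 f = (box_variation (bvol f) ptN1 pt1 - `|f pt0|)%:E ->
  jordan_fun f fp fm ->
  forall x, in01 x -> fp x + fm x + `|f pt0| = box_variation (bvol f) ptN1 x.
Proof.
move=> bf VE [fE [fp0 fm0] cp cm]; rewrite VE (VarHK0_cm cp) (VarHK0_cm cm) fp0 fm0 -EFinD.
move=> Vt'; have {Vt'} Vt := EFin_inj Vt'.
apply: (box_variation_eq (VarHK0_lty bf)).
- apply: (@eq_cm _ _ (fun x => fp x + fp x + (f pt0 + `|f pt0|))) => [x x01|].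
    by rewrite (fE x) //; lra.
  by apply: cmD; [exact: cmD|exact: cm_cst].
- apply: (@eq_cm _ _ (fun x => fm x + fm x + (`|f pt0| - f pt0))) => [x x01|].
    by rewrite (fE x) //; lra.
  by apply: cmD; [exact: cmD|exact: cm_cst].
- by rewrite fp0 fm0 !add0r.
- by lra.
Qed.

(** Both pairs have the same difference and the same sum: fp - fm is f - f(0), and fp + fm is the
    variation up to x minus its value |f(0)| at the origin. The distribution functions of [np] and
    [nm], less their values at 0, satisfy the same two equations. *)
Lemma represents_jordan_match (nu : {charge set T -> \bar R}) f :
  on_cube nu -> represents nu f -> jordan_match nu f.
Proof.
move=> on nu_f fp fm np nm jf jnu x x01.
have [npT nmT [_ bf] VE g1] := represents_total on nu_f jnu.
have nuE := jnu.2.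
have W := box_variation_eq (VarHK0_lty bf) (cm_plus npT nmT nuE nu_f)
  (cm_minus npT nmT nuE nu_f) (box_cdf_pt0 npT nmT nuE nu_f).
have Wx y : in01 y -> box_cdf np y + box_cdf nm y = box_variation (bvol f) ptN1 y.
  by apply: W; rewrite g1.
have J := jordan_fun_sum bf VE jf.
have [fE [fp0 fm0] _ _ _] := jf.
have fx := fE _ x01; have f0 := represents_box_cdf npT nmT nuE nu_f (@pt0_in01 R d).
have fx' := represents_box_cdf npT nmT nuE nu_f x01.
have Jx := J _ x01; have J0 := J _ (@pt0_in01 R d).
have Wx0 := Wx _ (@pt0_in01 R d); have Wxx := Wx _ x01.
have key (m : {measure set T -> \bar R}) : (m setT < +oo)%E ->
    m (box0 x `\ pt0) = (box_cdf m x - box_cdf m pt0)%:E.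
  move=> mT; rewrite EFinB -!(box_cdfE mT) -box0_pt0.
  have mx := @measurable_box0 R d x; have m0 := @measurable_box0 R d pt0.
  have b0x : box0 pt0 `<=` box0 x.
    by rewrite box0_pt0 => _ -> i; rewrite tnth_mktuple lexx; case/andP: (x01 i).
  have mxT : (m (box0 x) < +oo)%E.
    by apply: le_lt_trans mT; apply: le_measure; rewrite ?inE.
  by rewrite measureD // setIidr.
rewrite !key //; split; congr EFin; move: Jx J0; rewrite fp0 fm0; lra.
Qed.

Lemma charge_box_cdf (nu : {charge set T -> \bar R}) : represents nu (box_cdf nu).
Proof. by move=> x _; rewrite /box_cdf fineK // fin_num_measure //; exact: measurable_box0. Qed.

End Correspondence.

Unset Implicit Arguments.

Theorem theorem3 (R : realType) (d : nat) :
  (* (a) *)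
  (forall f : d.-tuple R -> R,
     right_continuous01 f -> bounded_HK f ->
     exists nu : {charge set (d.-tuple R) -> \bar R},
       [/\ on_cube nu, represents nu f,
           (forall nu' : {charge set (d.-tuple R) -> \bar R},
              on_cube nu' -> represents nu' f ->
              forall A, measurable A -> nu' A = nu A),
           var_identity nu f &
           jordan_match nu f]) /\
  (* (b) *)
  (forall nu : {charge set (d.-tuple R) -> \bar R},
     on_cube nu ->
     exists f : d.-tuple R -> R,
       [/\ right_continuous01 f /\ bounded_HK f, represents nu f,
           var_identity nu f,
           (forall g : d.-tuple R -> R,
              right_continuous01 g -> bounded_HK g -> represents nu g ->
              var_identity nu g ->
              forall x, in01 x -> g x = f x) &
           jordan_match nu f]).
Proof.
split=> [f rc bf|nu on].
  have [m1 [m2 [nu [on nu_f _ _]]]] := charge_exists rc bf.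
  exists nu; split=> //.
  - move=> nu' on' nu'_f A mA; apply: charge_box0_unique => // x x01.
    by rewrite nu_f // nu'_f.
  - exact: represents_var_identity.
  - exact: represents_jordan_match.
have nu_f := charge_box_cdf nu.
have [m1 [m2 nuE]] := charge_parts nu.
have m1T := finite_measure_lty m1; have m2T := finite_measure_lty m2.
exists (box_cdf nu); split=> //.
- split; first exact: (represents_rc m1T m2T nuE nu_f).
  exact: bounded_HK_dominated (represents_dominated m1T m2T nuE nu_f).
- exact: represents_var_identity.
- by move=> g _ _ nu_g _ x x01; apply: EFin_inj; rewrite -nu_g // nu_f.
- exact: represents_jordan_match.
Qed.
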